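(* Let $n\ge 2$ and $2\le k\le n-1$ be integers, and let $\mathscr{S}_n^k$ be the set of all $n$-vertex trees with exactly $k$ leaves. Then $T_n^k$ is, up to isomorphism, the unique tree in $\mathscr{S}_n^k$ that maximizes the number of leaf containing subtrees $F^*$ over $\mathscr{S}_n^k$, and $$F^*(T_n^k)=\left(\left\lfloor\tfrac{n-1}{k}\right\rfloor+1\right)^i\left(\left\lceil\tfrac{n-1}{k}\right\rceil+1\right)^j-\left\lfloor\tfrac{n-1}{k}\right\rfloor^i\left\lceil\tfrac{n-1}{k}\right\rceil^j+i\left\lfloor\tfrac{n-1}{k}\right\rfloor+j\left\lceil\tfrac{n-1}{k}\right\rceil,$$ where $i,j$ are nonnegative integers with $i+j=k$ and $n-1\equiv j\pmod k$.
   Context: All graphs are finite and simple. A leaf of a tree is a vertex of degree $1$. A subtree of a tree $T$ is a (nonempty) connected induced subgraph of $T$, and $F^*(T)$ denotes the number of subtrees of $T$ that contain at least one leaf of $T$ (leaf containing subtrees). A spider is a tree with at most one vertex of degree more than $2$, called the hub of the spider (if there is no vertex of degree more than $2$, any vertex can be taken as the hub). A leg of a spider is a path from the hub to a leaf. $T_n^k$ is the $n$-vertex spider with $k$ legs whose leg lengths $l_1,\dots,l_k$ are almost equal, i.e. $|l_i-l_j|\le 1$ for all $1\le i,j\le k$. *)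

(* Defs.v *)
From mathcomp Require Import all_boot.
Set Implicit Arguments.
Unset Strict Implicit.
Unset Printing Implicit Defensive.

Record sgraph := SGraph {
  vertex :> finType;
  adj : rel vertex;
  adj_sym : symmetric adj;
  adj_irrefl : irreflexive adj
}.

Arguments adj {s} x y.

Definition giso (G H : sgraph) : Prop :=
  exists f : G -> H, bijective f /\ forall x y, adj (f x) (f y) = adj x y.

Section Graph.
Variable G : sgraph.
Implicit Types (x y v h : G) (S : {set G}) (p : seq G).

Definition degree v : nat := #|[set w | adj v w]|.

Definition leaf v : bool := degree v == 1.

Definition leaves : {set G} := [set v | leaf v].

Definition induced S : rel G :=
  [rel x y | [&& x \in S, y \in S & adj x y]].

(* Nonempty vertex sets inducing a connected subgraph. When G is a tree, these
   are exactly the vertex sets of its subtrees. *)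
Definition connected_set S : bool :=
  (S != set0) && [forall x in S, forall y in S, connect (induced S) x y].

Definition acyclic : Prop :=
  forall p, 2 < size p -> ~ ucycle adj p.

Definition tree : Prop := connected_set [set: G] /\ acyclic.

Definition Fstar : nat :=
  #|[set S | connected_set S & [exists v in S, leaf v]]|.

Definition spider : Prop := tree /\ #|[set v | 2 < degree v]| <= 1.

(* In a spider, this singles out the vertex of degree more than 2 if there is
   one, and otherwise allows any vertex. *)
Definition hub h : Prop := forall v, 2 < degree v -> v = h.

(* p lists the vertices of the path other than h, so the length of the leg is
   size p. *)
Definition leg h p : bool :=
  [&& path adj h p, uniq (h :: p) & leaf (last h p)].

Definition balanced_spider (n k : nat) : Prop :=
  [/\ #|G| = n, spider &
      exists h (legs : seq (seq G)),
        [/\ hub h,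
            uniq legs /\ size legs = k,
            forall p, (p \in legs) = leg h p &
            forall p q, p \in legs -> q \in legs -> size p <= size q + 1]].

Definition tree_with_leaves (n k : nat) : Prop :=
  [/\ tree, #|G| = n & #|leaves| = k].

End Graph.

Definition Fstar_maximizer (n k : nat) (T : sgraph) : Prop :=
  tree_with_leaves T n k /\
  forall G : sgraph, tree_with_leaves G n k -> Fstar G <= Fstar T.

Definition ceil_div (m k : nat) : nat := (m + k.-1) %/ k.

Lemma ceil_div_leq m k c : 0 < k -> (ceil_div m k <= c) = (m <= c * k).
Proof.
case: k => // k _; rewrite /ceil_div /= -ltnS ltn_divLR // mulSn.
by rewrite addSn ltnS addnC leq_add2l.
Qed.

(* Main.v *)
Require Import Defs.
From mathcomp Require Import all_boot zify ring.
Set Implicit Arguments.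
Unset Strict Implicit.
Unset Printing Implicit Defensive.

(** Root a tree at [h]. Each subtree has a unique vertex closest to [h], its
top, and the subtrees with top [t] are [t] together with an order ideal of the
forest hanging below [t]. So [Fstar] is the sum over [t] of the number of ideals
below [t] minus the number of those that, together with [t], contain no leaf. It
depends only on the shape of the rooted tree, which [forest] records.

Split the tree minus [h] into downward paths, one for each leaf, and let
[l_1, ..., l_k] be their lengths, so that they add up to [n - 1]. A spider with
these legs has [prod (l_i + 1) - prod l_i + sum l_i] leaf containing subtrees:
those through the hub are given by an initial segment of each leg, at least one
of them the whole leg, and those avoiding the hub are the final segments of legs.
In an arbitrary tree a subtree through [h] still meets each path in an initial
segment, but not all combinations are connected; in exchange more than [n - 1]
leaf containing subtrees may avoid [h]. The heart of the proof is that the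
deficit outweighs the excess. For a forest with [m] vertices,
[dominated_forest] bounds the excess by [m] times the deficit of leaf containing
ideals, plus the deficit of leafless ideals, and this bound is strict as soon as
some vertex branches. Seen from the root, the two deficits of one branch are
multiplied by the number of all ideals and by the number of leaf containing ideals
of the other branches. The former is at least the number of vertices outside the
branch, hence at least [m] if the branch does not hold more than half of the
vertices, and the latter is positive. Therefore [root_bound] gives the
spider bound when [h] is a centroid, and [centroid_exists] finds one as a vertex
of least total distance. Equality forces the tree to be a spider with hub [h].

For spiders, moving one vertex from a leg to one shorter by at least two never
decreases the value and increases it when [k > 2] ([smoothing]), so balanced legs
are optimal. When [k = 2] the value does not depend on the lengths, but the two
branches at a centroid are automatically balanced. Finally a spider is
determined up to isomorphism by its multiset of leg lengths ([unbranched_giso]),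
and balanced lists of given length and sum are equal up to order
([sort_balanced]). Existence is witnessed by joining each [v > 0] to
the truncated difference [v - k]. *)

(** * Rooted forests and the comparison with a spider *)

(** Left-child right-sibling encoding: [fcons f g] is a tree whose root carries
    the forest [f], followed by the further trees [g]. It makes a plain structural
    induction available for both the children and the siblings of a vertex. *)
Inductive forest := fnil | fcons (f g : forest).

Definition is_nil f := if f is fnil then true else false.
Definition is_single f := if f is fcons _ fnil then true else false.

Fixpoint fsize f := if f is fcons f g then (fsize f + fsize g).+1 else 0.

(** An order ideal is a set of vertices closed under taking parents; a tree
    contributes either nothing or its root and an ideal of the forest below. *)
Fixpoint ideals f := if f is fcons f g then (ideals f).+1 * ideals g else 1.

(** Here only the ideals without leaves are counted: a tree reduced to its root
    contributes nothing to such an ideal. *)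
Fixpoint inner_ideals f :=
  if f is fcons f g then (~~ is_nil f * inner_ideals f).+1 * inner_ideals g
  else 1.

(** The leaf containing subtrees inside the forest, sorted by their top vertex. *)
Fixpoint leafy f :=
  if f is fcons f g then
    leafy f + (ideals f - ~~ is_nil f * inner_ideals f) + leafy g
  else 0.

(** Lengths of the paths obtained by letting each vertex that is not a leaf
    prolong the path of its first child. *)
Fixpoint path_lengths f :=
  if f is fcons f g then
    (if path_lengths f is p :: ps then p.+1 :: ps else [:: 1]) ++ path_lengths g
  else [::].

Fixpoint unbranched f :=
  if f is fcons f g then
    [&& is_nil f || is_single f, unbranched f & unbranched g]
  else true.

Fixpoint branch_sizes f :=
  if f is fcons f g then (fsize f).+1 :: branch_sizes g else [::].

(** A spider with legs [ls] has [prodS ls] subtrees through its hub, of which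
    [prod0 ls] contain no leaf. *)
Definition prodS ls := \prod_(l <- ls) l.+1.
Definition prod0 ls := \prod_(l <- ls) l.

Lemma prodS_cons l ls : prodS (l :: ls) = l.+1 * prodS ls.
Proof. by rewrite /prodS big_cons. Qed.
Lemma prod0_cons l ls : prod0 (l :: ls) = l * prod0 ls.
Proof. by rewrite /prod0 big_cons. Qed.
Lemma prodS_cat ls ls' : prodS (ls ++ ls') = prodS ls * prodS ls'.
Proof. by rewrite /prodS big_cat. Qed.
Lemma prod0_cat ls ls' : prod0 (ls ++ ls') = prod0 ls * prod0 ls'.
Proof. by rewrite /prod0 big_cat. Qed.

Lemma sumn_path_lengths f : sumn (path_lengths f) = fsize f.
Proof.
elim: f => //= f <- g <-; rewrite sumn_cat.
by case: (path_lengths f) => [|p ps] //=; rewrite addSn addnA.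
Qed.

Lemma path_lengths_gt0 f : all (leq 1) (path_lengths f).
Proof.
elim: f => //= f IHf g IHg; rewrite all_cat IHg andbT.
by case: (path_lengths f) IHf => [|p ps] //= /andP[_ ->].
Qed.

Lemma path_lengths_nil f : (path_lengths f == [::]) = is_nil f.
Proof. by case: f => //= f g; case: (path_lengths f). Qed.

Lemma prod0_gt0 ls : all (leq 1) ls -> 0 < prod0 ls.
Proof.
elim: ls => [|l ls IH] /=; first by rewrite /prod0 big_nil.
by rewrite prod0_cons muln_gt0 => /andP[-> /IH].
Qed.

Lemma prod0_leS ls : prod0 ls <= prodS ls.
Proof.
elim: ls => [|l ls IH]; first by rewrite /prod0 /prodS !big_nil.
by rewrite prod0_cons prodS_cons leq_mul.
Qed.

Lemma prod0_ltS l ls : prod0 (l :: ls) < prodS (l :: ls).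
Proof.
rewrite prod0_cons prodS_cons.
have := prod0_leS ls; have : 0 < prodS ls by rewrite prodn_gt0.
nia.
Qed.

(** [s] counts leaf containing subtrees and [m] vertices; [r], [r0] count ideals
    and leafless ideals, [q], [q0] the same for the spider with the same path
    lengths. Free of subtractions, the last clause says that
    [s <= m + m * ((q - q0) - (r - r0)) + (q0 - r0)], strictly if [e]. *)
Definition dominated (s m r r0 q q0 : nat) (e : bool) :=
  [/\ [/\ 0 < r0, r0 <= r, r0 <= q0 & m < r], r + q0 <= q + r0 &
      s + m * (r + q0) + r0 + e <= m + m * (q + r0) + q0].

(** Naming the gaps turns all differences into sums, so that products of counts
    expand into monomials: [x] is the number of leaf containing ideals, [a] and
    [b] are the deficits of leafless and of leaf containing ideals. *)
Lemma dominatedP s m r r0 q q0 e : dominated s m r r0 q q0 e <->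
  exists x a b, [/\ r = r0 + x, q0 = r0 + a & q = r0 + x + a + b]
  /\ [/\ 0 < r0, m < r & s + e <= m + m * b + a].
Proof.
split.
  case=> [[h1 h2 h3 h4] h5 h6].
  exists (r - r0), (q0 - r0), (q + r0 - (r + q0)); split; split; try lia.
  rewrite mulnBr. have : m * (r + q0) <= m * (q + r0) by rewrite leq_mul2l h5 orbT.
  lia.
by case=> x [a [b [[-> -> ->] [h1 h2 h3]]]]; split; [split|..]; nia.
Qed.

(** Side by side, both deficits grow at least additively, because every ideal of
    one part can be combined with the empty ideal of the other; the bound is
    therefore additive. *)
Lemma dominated_union s1 m1 r1 r01 q1 q01 e1 s2 m2 r2 r02 q2 q02 e2 :
  dominated s1 m1 r1 r01 q1 q01 e1 -> dominated s2 m2 r2 r02 q2 q02 e2 ->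
  dominated (s1 + s2) (m1 + m2) (r1 * r2) (r01 * r02) (q1 * q2) (q01 * q02)
    (e1 || e2).
Proof.
move=> /dominatedP[x [a [b [[-> -> ->] [h1 h2 h3]]]]].
move=> /dominatedP[x' [a' [b' [[-> -> ->] [h1' h2' h3']]]]].
apply/dominatedP.
(* the gaps of the products, expanded *)
exists (r01 * x' + x * r02 + x * x'), (r01 * a' + a * r02 + a * a').
pose c := x * a' + a * x' + b * b' + b * x' + b * a' + x * b' + a * b'.
exists (r01 * b' + b * r02 + c).
split; first by rewrite /c; split; ring.
have ha : a + a' <= r01 * a' + a * r02 + a * a'.
  rewrite addnC -addnA leq_add ?leq_pmull //.
  by apply: leq_trans (leq_addr _ _); rewrite leq_pmulr.
have hb : b + b' <= r01 * b' + b * r02 + c.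
  rewrite addnC -addnA leq_add ?leq_pmull //.
  by apply: leq_trans (leq_addr _ _); rewrite leq_pmulr.
split; first by rewrite muln_gt0 h1.
  apply: leq_trans (_ : m1.+1 * m2.+1 <= _); last exact: leq_mul.
  by rewrite mulSn mulnS; lia.
have := leq_mul (leqnn (m1 + m2)) hb.
have : (e1 || e2) <= e1 + e2 by case: (e1) (e2) => [] [].
rewrite mulnDl !mulnDr; lia.
Qed.

(** Putting a root under the forest adds [r - r0] subtrees, those with the new
    top. It also lengthens the first path, of length [p], which adds the
    contribution [B - B0] of the remaining paths to the deficit of leaf
    containing ideals. As that deficit is now taken [m + 1] times, the identity
    [q - q0 = (p + 1) * (B - B0) + B0] pays for the new subtrees, with something
    left over when there are further paths. *)
Lemma dominated_node s m r r0 q q0 e p B B0 :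
  dominated s m r r0 q q0 e -> p <= m -> 0 < B0 -> B0 <= B ->
  q = p.+1 * B -> q0 = p * B0 ->
  dominated (s + (r - r0)) m.+1 r.+1 r0.+1 (q + B) (q0 + B0)
    (e || (p < m) && (B0 < B)).
Proof.
move=> /dominatedP[x [a [b [[-> -> ->] [h1 h2 h3]]]]] pm B0gt le_B eq_q eq_q0.
apply/dominatedP; exists x, (a + B0 - 1), (b + (B - B0)).
have -> : r0 + x - r0 = x by lia.
split; split; try lia.
have : x + b = p.+1 * (B - B0) + B0 by rewrite mulnBr; nia.
have : (p < m) && (B0 < B) + p.+1 * (B - B0) <= m.+1 * (B - B0).
  case: ltnP => /= [lt_pm|_]; last by rewrite leq_mul2r ltnS pm orbT.
  apply: leq_trans (_ : (p.+2) * (B - B0) <= _); last by rewrite leq_mul2r ltnS lt_pm orbT.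
  by rewrite [p.+2 * _]mulSn leq_add2r; case: ltnP; rewrite // subn_gt0.
have : e || (p < m) && (B0 < B) <= e + ((p < m) && (B0 < B)) by case: (e); case: (_ && _).
by nia.
Qed.

(** Strictness enters at a branching vertex: below it there is a second path, so
    that the first one is shorter than the number of vertices. *)
Lemma dominated_forest f :
  dominated (leafy f) (fsize f) (ideals f) (inner_ideals f)
    (prodS (path_lengths f)) (prod0 (path_lengths f)) (~~ unbranched f).
Proof.
elim: f => [|f IHf g IHg] /=.
  by rewrite /prodS /prod0 !big_nil.
rewrite prodS_cat prod0_cat -addSn !negb_and orbA.
apply: dominated_union => // {IHg g}.
case: f IHf => [|f g] IHf; first by rewrite /prodS /prod0 !big_seq1.
set h := fcons f g in IHf *.
case Dd: (path_lengths h) (path_lengths_nil h) IHf => [|p ps] // _ IHf; rewrite /= mul1n.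
rewrite prodS_cons prod0_cons.
have gt0: all (leq 1) (p :: ps) by rewrite -Dd path_lengths_gt0.
have eq_m : fsize h = p + sumn ps by rewrite -sumn_path_lengths Dd.
have le_pm : p <= fsize h by rewrite eq_m leq_addr.
have := dominated_node IHf le_pm (prod0_gt0 (proj2 (andP gt0))) (prod0_leS ps)
  (prodS_cons _ _) (prod0_cons _ _).
rewrite prodS_cons prod0_cons.
have -> : p.+1 * prodS ps + prodS ps = p.+2 * prodS ps by ring.
have -> : p * prod0 ps + prod0 ps = p.+1 * prod0 ps by ring.
suff le_e : (~~ is_single h || ~~ unbranched h) <=
    (~~ unbranched h || (p < fsize h) && (prod0 ps < prodS ps)).
  by case=> h1 h2 h3; split=> //; apply: leq_trans h3; rewrite leq_add2l.
suff multi : ~~ is_single h -> (p < fsize h) && (prod0 ps < prodS ps).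
  by case: (is_single h) multi => [_|->]; case: (unbranched h); rewrite ?orbT.
case: ps eq_m gt0 Dd {IHf le_pm} => [|p' ps] eq_m gt0 Dd multi.
  have : size (path_lengths h) = 1 by rewrite Dd.
  case: g @h multi {eq_m gt0 Dd} => // f' g h _; rewrite /h /= !size_cat.
  by case: (path_lengths f) (path_lengths f') => [|? ?] [|? ?] /=; lia.
rewrite prod0_ltS andbT eq_m /=.
by case/and3P: gt0 => _ + _; lia.
Qed.

Lemma inner_ideals_lt f : ~~ is_nil f -> inner_ideals f < ideals f.
Proof.
elim: f => // f IHf g IHg _ /=.
have le_g : inner_ideals g <= ideals g by case: (g) IHg => // ? ? /(_ isT)/ltnW.
have g0 : 0 < ideals g by case: (dominated_forest g) => [[]]; lia.
have lt_f : ~~ is_nil f * inner_ideals f < ideals f.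
  by case: (f) IHf => // f1 f2 IHf; rewrite mul1n IHf.
apply: leq_ltn_trans (_ : (~~ is_nil f * inner_ideals f).+1 * ideals g < _).
  by rewrite leq_mul2l le_g orbT.
by rewrite ltn_pmul2r.
Qed.

(** When the rest of the tree admits [Z] ideals, of which [Z0] are leafless, the
    deficits of a branch are multiplied by [Z] and [Z - Z0]; this absorbs the
    excess of a branch with at most [Z] vertices. *)
Lemma dominated_context s m r r0 q q0 e Z Z0 :
  dominated s m r r0 q q0 e -> Z0 < Z -> m <= Z ->
  s + (Z * r + Z0 * q0) + e <= m + (Z * q + Z0 * r0).
Proof.
case/dominatedP=> x [a [b [[-> -> ->] [_ _ le_s]]]] ltZ le_mZ.
have := leq_mul le_mZ (leqnn b).
have := leq_mul (ltZ) (leqnn a); rewrite mulSn.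
rewrite !mulnDr; lia.
Qed.

(** The situation in which the branches of [f] are straightened one after the
    other: [A], [A0] are the products of the spider counts of the branches already
    treated, which have [M] vertices altogether, and no remaining branch holds more
    than half of the whole tree. The disjunction guarantees that the context of
    each branch has an ideal containing a leaf. *)
Definition branches_outweighed f A A0 M :=
  [&& 0 < A0, A0 <= A, M < A, (A0 < A) || ~~ is_single f &
      all (fun b => 2 * b <= (M + fsize f).+1) (branch_sizes f)].

(** One branch is straightened in the context of the others, and then joins the
    accumulated products, which only helps the branches that remain. *)
Lemma root_bound_context f A A0 M : branches_outweighed f A A0 M ->
  leafy f + (A * ideals f + A0 * prod0 (path_lengths f)) + ~~ unbranched f <=
  fsize f + (A * prodS (path_lengths f) + A0 * inner_ideals f).
Proof.
elim: f A A0 M => [|t _ g IHg] A A0 M.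
  by rewrite /= /prodS /prod0 !big_nil; lia.
case/and5P=> A0gt leA ltM ltA /andP[le_t le_g].
have dom_t := dominated_forest (fcons t fnil).
set lt := (if path_lengths t is p :: ps then p.+1 :: ps else [:: 1]).
rewrite [path_lengths (fcons t fnil)]/= cats0 -/lt in dom_t.
have -> : path_lengths (fcons t g) = lt ++ path_lengths g by [].
have -> : unbranched (fcons t g) = unbranched (fcons t fnil) && unbranched g.
  by rewrite /= andbT andbA.
have -> : ideals (fcons t g) = ideals (fcons t fnil) * ideals g.
  by rewrite /= muln1.
have -> : inner_ideals (fcons t g) = inner_ideals (fcons t fnil) * inner_ideals g.
  by rewrite /= muln1.
have -> : leafy (fcons t g) = leafy (fcons t fnil) + leafy g.
  by rewrite /= addn0.
have sz_t : fsize (fcons t fnil) = (fsize t).+1 by rewrite /= addn0.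
have -> : fsize (fcons t g) = fsize (fcons t fnil) + fsize g.
  by rewrite /= addn0.
rewrite prodS_cat prod0_cat.
have lt_q : prod0 lt < prodS lt.
  by rewrite /lt; case: (path_lengths t) => [|? ?]; apply: prod0_ltS.
have [[gi1 le_gi _ gi2] _ _] := dominated_forest g.
have lt_gi : A0 * inner_ideals g < A * ideals g.
  case/orP: ltA => [ltA|].
    by apply: leq_ltn_trans (leq_mul (leqnn _) le_gi) _; rewrite ltn_mul2r ltA andbT; lia.
  case: (g) (@inner_ideals_lt g) => // g1 g2 /(_ isT) lt_g _.
  by apply: leq_ltn_trans (leq_mul leA (leqnn _)) _; rewrite ltn_mul2l lt_g andbT; lia.
have le_m : fsize (fcons t fnil) <= A * ideals g.
  have: M.+1 * (fsize g).+1 <= A * ideals g by apply: leq_mul.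
  rewrite mulSn mulnS sz_t; move: le_t => /=; lia.
have [[t1 _ t2 t3] t4 _] := dom_t; rewrite sz_t in t3.
have {IHg} := IHg (A * prodS lt) (A0 * prod0 lt) (M + (fsize t).+1).
have -> : branches_outweighed g (A * prodS lt) (A0 * prod0 lt) (M + (fsize t).+1).
  apply/and5P; split.
  - by rewrite muln_gt0 A0gt; lia.
  - by rewrite leq_mul // ltnW.
  - have: M.+1 * (fsize t).+2 <= A * prodS lt by apply: leq_mul => //; lia.
    rewrite mulSn mulnS; lia.
  - apply/orP; left; apply: leq_ltn_trans (leq_mul leA (leqnn _)) _.
    by rewrite ltn_mul2l lt_q andbT; lia.
  - by apply: sub_all le_g => b; rewrite -addnA addSn.
move/(_ isT); have := dominated_context dom_t lt_gi le_m.
have: (~~ (unbranched (fcons t fnil) && unbranched g)) <=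
      ~~ unbranched (fcons t fnil) + ~~ unbranched g.
  by case: (unbranched g); case: (unbranched _).
rewrite ![_ * ideals g * _]mulnAC ![_ * inner_ideals g * _]mulnAC !mulnA.
lia.
Qed.

(** The case with no branch treated yet. A root with a single branch is excluded
    because the context of that branch would be the root alone, which offers no
    leaf containing ideal to multiply the deficit of leafless ideals. *)
Lemma root_bound f : ~~ is_single f ->
    all (fun b => 2 * b <= (fsize f).+1) (branch_sizes f) ->
  leafy f + (ideals f + prod0 (path_lengths f)) + ~~ unbranched f <=
  fsize f + (prodS (path_lengths f) + inner_ideals f).
Proof.
move=> multi small; have := @root_bound_context f 1 1 0.
by rewrite /branches_outweighed multi !mul1n; apply.
Qed.

(** * Spiders as forests *)

Definition chain n := iter n (fun f => fcons f fnil) fnil.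
(** The branches at the hub of the spider with legs [ls]. *)
Definition chains ls := foldr (fun l g => fcons (chain l.-1) g) fnil ls.

Lemma chain_data n : [/\ ideals (chain n) = n.+1, fsize (chain n) = n,
   ~~ is_nil (chain n) * inner_ideals (chain n) = n & leafy (chain n) = n].
Proof.
elim: n => //= n [-> -> -> ->]; split; lia.
Qed.

Lemma unbranched_chain f : is_nil f || is_single f -> unbranched f ->
  f = chain (fsize f).
Proof.
elim: f => // f IHf [|//] _ _ /= /and3P[nb ub _].
by rewrite addn0 /= -IHf.
Qed.

Lemma unbranched_chains f : unbranched f -> f = chains (branch_sizes f).
Proof.
by elim: f => //= f _ g IHg /and3P[nb ub /IHg <-]; rewrite -unbranched_chain.
Qed.

Lemma path_lengths_chains ls : all (leq 1) ls -> path_lengths (chains ls) = ls.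
Proof.
elim: ls => //= l ls IH /andP[l1 /IH ->].
suff -> : path_lengths (chain l.-1) = nseq (l.-1 != 0) l.-1.
  by case: l l1 => [|[|l]].
elim: {l l1}l.-1 => //= n ->; rewrite cats0; by case: n.
Qed.

Lemma branch_sizes_gt0 f : all (leq 1) (branch_sizes f).
Proof. by elim: f. Qed.

Lemma path_lengths_unbranched f : unbranched f -> path_lengths f = branch_sizes f.
Proof. by move/unbranched_chains=> {1}->; rewrite path_lengths_chains ?branch_sizes_gt0. Qed.

Lemma chains_data ls : all (leq 1) ls ->
  [/\ ideals (chains ls) = prodS ls, inner_ideals (chains ls) = prod0 ls
    & leafy (chains ls) = sumn ls].
Proof.
elim: ls => [|l ls IH] /=; first by rewrite /prodS /prod0 !big_nil.
case/andP=> l1 /IH[-> -> ->].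
have [-> _ -> ->] := chain_data l.-1; rewrite prednK // prodS_cons prod0_cons.
by split=> //; lia.
Qed.

(** * Optimal leg lengths *)

Definition balanced ls := all (fun p => all (fun q => p <= q + 1) ls) ls.

Lemma balancedP ls :
  reflect (forall p q, p \in ls -> q \in ls -> p <= q + 1) (balanced ls).
Proof.
apply: (iffP allP) => [bal p q /bal/allP|bal p lp]; first by apply.
by apply/allP=> q; apply: bal.
Qed.

Definition balanced_list N k :=
  nseq (k - N %% k) (N %/ k) ++ nseq (N %% k) (N %/ k).+1.

Lemma balanced_two_values ls : balanced ls -> ls != [::] ->
  exists a i j, 0 < i /\ perm_eq ls (nseq i a ++ nseq j a.+1).
Proof.
case: ls => // l0 ls /balancedP bal _; set s := l0 :: ls in bal *.
have ex_s : exists a, a \in s by exists l0; rewrite mem_head.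
clearbody s => {l0 ls}.
have [a a_s min_a] := ex_minnP ex_s.
exists a, (count_mem a s), (count_mem a.+1 s).
split; first by rewrite -has_count has_pred1.
apply/allP=> x _ /=; apply/eqP; rewrite count_cat !count_nseq /=.
have [eq_x|nxa] := eqVneq a x; have [eq_x'|nxa'] := eqVneq a.+1 x;
  rewrite ?mul0n ?mul1n ?addn0 -?eq_x -?eq_x' //.
  by move: eq_x eq_x'; lia.
rewrite ?mul0n /= ?mul0n; apply/count_memPn/negP=> x_s.
move: (min_a _ x_s) (bal _ _ x_s a_s); lia.
Qed.

(** A balanced list takes only the values [a] and [a + 1] with [a] its minimum,
    and its sum is then a Euclidean division by its length. *)
Lemma sort_balanced ls : balanced ls -> ls != [::] ->
  sort leq ls = balanced_list (sumn ls) (size ls).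
Proof.
move=> bal nz; have [a [i [j [i_gt0 eq_ls]]]] := balanced_two_values bal nz.
have sz : size ls = i + j by rewrite (perm_size eq_ls) size_cat !size_nseq.
have sm : sumn ls = a * (i + j) + j.
  by rewrite (perm_sumn eq_ls) sumn_cat !sumn_nseq mulSn mulnDr; lia.
have lt_j : j < i + j by lia.
rewrite /balanced_list sz sm divnMDl ?modnMDl; last by lia.
rewrite modn_small // divn_small // addn0 addnK.
apply: (sorted_eq leq_trans anti_leq); first exact: (sort_sorted leq_total).
  rewrite (sorted_pairwise leq_trans) pairwise_cat -!(sorted_pairwise leq_trans).
  apply/and3P; split; last 2 first.
  - by apply: path_sorted (_ : path _ a _); elim: (i) => //= i' ->; rewrite leqnn.
  - by apply: path_sorted (_ : path _ a.+1 _); elim: (j) => //= j' ->; rewrite leqnn.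
  by apply/allrelP=> x y /nseqP[-> _] /nseqP[-> _].
by rewrite perm_sort.
Qed.

(** Number of leaf containing subtrees of the spider with legs [ls]. *)
Definition spider_value ls := prodS ls - prod0 ls + sumn ls.

Lemma perm_spider_value ls ls' : perm_eq ls ls' -> spider_value ls = spider_value ls'.
Proof.
move=> eq_ls; rewrite /spider_value /prodS /prod0.
by rewrite (perm_big _ eq_ls) (perm_big _ eq_ls) /= (perm_sumn eq_ls).
Qed.

Lemma unbalanced_split ls : ~~ balanced ls ->
  exists x y rest, perm_eq ls (x :: y :: rest) /\ y.+1 < x.
Proof.
case/allPn=> x lx /allPn[y ly]; rewrite -ltnNge addn1 => lt_yx.
exists x, y, (rem y (rem x ls)); split=> //.
have ly' : y \in rem x ls.
  have nyx : y == x = false by apply/eqP; lia.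
  by move: ly; rewrite (perm_mem (perm_to_rem lx)) in_cons nyx.
by apply: perm_trans (perm_to_rem lx) _; rewrite perm_cons perm_to_rem.
Qed.

(** The change in [prodS] and the change in [prod0] both have the factor
    [x - y - 1], so that the gain is this factor times the difference between the
    two products over the other legs, which vanishes only without other legs. *)
Lemma smoothing_gain x y rest : y.+1 < x ->
  spider_value [:: x, y & rest] + (2 < (size rest).+2)
    <= spider_value [:: x.-1, y.+1 & rest].
Proof.
move=> lt_yx.
have le_P := prod0_leS rest.
have lt_P : (2 < (size rest).+2) <= prodS rest - prod0 rest.
  by case: (rest) => // l r; rewrite subn_gt0 prod0_ltS.
rewrite /spider_value !prodS_cons !prod0_cons /=.
set P := prodS rest in le_P lt_P *; set P0 := prod0 rest in le_P lt_P *.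
have -> : x.-1 + (y.+1 + sumn rest) = x + (y + sumn rest) by lia.
suff : x.+1 * (y.+1 * P) - x * (y * P0) + (2 < (size rest).+2) <=
    x.-1.+1 * (y.+2 * P) - x.-1 * (y.+1 * P0) by lia.
have [d eq_P] : exists d, P = P0 + d by exists (P - P0); lia.
have [z eq_x] : exists z, x = y.+2 + z by exists (x - y.+2); lia.
rewrite eq_P in lt_P *; rewrite eq_x /=.
have {}lt_P : (2 < (size rest).+2) <= d by lia.
set e := nat_of_bool _ in lt_P *.
have -> : (y.+2 + z).+1 * (y.+1 * (P0 + d)) = (y.+2 + z) * (y * P0) +
    ((y.+2 + z) * P0 + y.+1 * P0 + (y.+2 + z).+1 * y.+1 * d) by ring.
have -> : (y.+1 + z).+1 * (y.+2 * (P0 + d)) = (y.+1 + z) * (y.+1 * P0) +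
    ((y.+1 + z) * P0 + y.+2 * P0 + (y.+1 + z).+1 * y.+2 * d) by ring.
rewrite !addKn; nia.
Qed.

(** The sum of squares is the measure on which smoothing terminates. *)
Lemma smoothing ls : all (leq 1) ls -> ~~ balanced ls ->
  exists ls', [/\ all (leq 1) ls', size ls' = size ls, sumn ls' = sumn ls,
    spider_value ls + (2 < size ls) <= spider_value ls' &
    sumn [seq l ^ 2 | l <- ls'] < sumn [seq l ^ 2 | l <- ls]].
Proof.
move=> pos /unbalanced_split[x [y [rest [eq_ls lt_yx]]]].
rewrite (perm_spider_value eq_ls) (perm_size eq_ls) (perm_sumn eq_ls).
rewrite (perm_sumn (perm_map _ eq_ls)).
move: pos; rewrite (perm_all _ eq_ls) => /= /and3P[x0 y0 pos].
exists (x.-1 :: y.+1 :: rest); split=> //=.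
- by apply/andP; split=> //; lia.
- lia.
- exact: smoothing_gain.
- by rewrite !addnA ltn_add2r; nia.
Qed.

Lemma spider_value_le_balanced ls : all (leq 1) ls ->
  exists ls', [/\ balanced ls', size ls' = size ls, sumn ls' = sumn ls &
    spider_value ls + (~~ balanced ls && (2 < size ls)) <= spider_value ls'].
Proof.
have [N] := ubnP (sumn [seq l ^ 2 | l <- ls]).
elim: N ls => // N IH ls lt_N pos.
have [bal|nbal] := boolP (balanced ls).
  by exists ls; rewrite addn0.
have [ls1 [pos1 sz1 sm1 le1 lt1]] := smoothing pos nbal.
have [ls2 [bal2 sz2 sm2 le2]] := IH ls1 (leq_trans lt1 lt_N) pos1.
exists ls2; split; rewrite ?sz2 ?sm2 //.
exact: leq_trans le1 (leq_trans (leq_addr _ _) le2).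
Qed.

Lemma spider_value_balanced ls ls' : balanced ls -> balanced ls' -> ls != [::] ->
  size ls = size ls' -> sumn ls = sumn ls' -> spider_value ls = spider_value ls'.
Proof.
move=> bal bal' nz eq_sz eq_sm.
have nz' : ls' != [::] by rewrite -size_eq0 -eq_sz size_eq0.
apply: perm_spider_value; rewrite -(perm_sort leq) sort_balanced // eq_sz eq_sm.
by rewrite -sort_balanced // perm_sort.
Qed.

Lemma spider_value_max ls ls' : all (leq 1) ls -> balanced ls' -> ls != [::] ->
    size ls = size ls' -> sumn ls = sumn ls' ->
  spider_value ls + (~~ balanced ls && (2 < size ls)) <= spider_value ls'.
Proof.
move=> pos bal' nz eq_sz eq_sm.
have [ls1 [bal1 sz1 sm1 le1]] := spider_value_le_balanced pos.
rewrite (@spider_value_balanced ls' ls1) -?sz1 -?sm1 //; first by rewrite sz1.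
- by rewrite -size_eq0 -eq_sz size_eq0.
- by rewrite sz1.
- by rewrite sm1.
Qed.

(** The two admissible choices of [(i, j)] when [k] divides [N], namely [(k, 0)]
    and [(0, k)], agree because then both quotients coincide. *)
Lemma spider_value_formula N k i j ls : 0 < k -> i + j = k -> N = j %[mod k] ->
    balanced ls -> size ls = k -> sumn ls = N ->
  let a := N %/ k in let b := ceil_div N k in
  spider_value ls = (a + 1) ^ i * (b + 1) ^ j - a ^ i * b ^ j + i * a + j * b.
Proof.
move=> k0 eq_k eqNj bal sz sm a b.
have nz : ls != [::] by rewrite -size_eq0 sz; lia.
have eqN := divn_eq N k; rewrite -/a in eqN.
have lt_m : N %% k < k by rewrite ltn_pmod.
suff eq_ls : perm_eq ls (nseq i a ++ nseq j b).
  rewrite (perm_spider_value eq_ls) /spider_value prodS_cat prod0_cat sumn_cat !sumn_nseq.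
  rewrite /prodS /prod0 !big_nseq !iter_muln !muln1.
  by rewrite !addn1 !(mulnC _ a) !(mulnC _ b) addnA.
rewrite -(perm_sort leq) sort_balanced // sz sm /balanced_list -/a.
have [le_kj|lt_jk] := leqP k j.
  have [i0 ->] : i = 0 /\ j = k by lia.
  have m0 : N %% k = 0 by rewrite eqNj (_ : j = k) ?modnn //; lia.
  rewrite m0 subn0 cats0 i0 /=.
  suff -> : b = a by [].
  rewrite /b /ceil_div eqN m0 addn0 divnMDl // divn_small ?addn0 //; lia.
rewrite eqNj (modn_small lt_jk) (_ : k - j = i); last by lia.
case: j => [|j] in eq_k eqNj lt_jk *; first by rewrite !cats0.
suff -> : b = a.+1 by [].
rewrite /b /ceil_div eqN eqNj (modn_small lt_jk).
have -> : a * k + j.+1 + k.-1 = a.+1 * k + j by rewrite mulSn; lia.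
by rewrite divnMDl // divn_small ?addn0 //; lia.
Qed.

(** * Rooting a tree *)

(** Taking [par h = h] makes [par] total, so that the descendants of [c] are the
    vertices whose [par]-orbit meets [c]. *)
Record rooted (G : sgraph) (h : G) (par : G -> G) (depth : G -> nat) : Prop :=
  Rooted {
    par_root : par h = h;
    depth_root : depth h = 0;
    depth_par : forall v, v != h -> depth v = (depth (par v)).+1;
    adj_par : forall x y,
      adj x y = (x != h) && (par x == y) || (y != h) && (par y == x)
  }.

Lemma rooted_adj_par (G : sgraph) (h : G) par depth v :
  @rooted G h par depth -> v != h -> adj v (par v).
Proof. by move=> Gr nv; rewrite (adj_par Gr) nv eqxx. Qed.

Lemma rooted_ind (G : sgraph) (h : G) par depth (P : G -> Prop) : @rooted G h par depth ->
  P h -> (forall v, v != h -> P (par v) -> P v) -> forall v, P v.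
Proof.
move=> Gr Ph IH v; have [n] := ubnP (depth v); elim: n v => // n IHn v lt_n.
have [->//|nv] := eqVneq v h.
by apply: IH => //; apply: IHn; rewrite -ltnS -(depth_par Gr).
Qed.

Lemma rooted_adj_depth (G : sgraph) (h : G) par depth u v : @rooted G h par depth ->
  adj v u -> depth u <= depth v -> v != h /\ u = par v.
Proof.
move=> Gr; rewrite (adj_par Gr) => /orP[/andP[-> /eqP->//]|/andP[nu /eqP <-]].
by rewrite (depth_par Gr nu) ltnn.
Qed.

Lemma adjC (G : sgraph) (x y : G) : adj x y = adj y x.
Proof. exact: adj_sym. Qed.

(** Both neighbours on a cycle of a vertex of maximal depth would be its parent. *)
Lemma rooted_acyclic (G : sgraph) (h : G) par depth : @rooted G h par depth -> acyclic G.
Proof.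
move=> Gr p sz_p /andP[cyc_p uniq_p].
have [v0 v0p] : exists v0, v0 \in p.
  by case: (p) sz_p => // v0 ? _; exists v0; rewrite mem_head.
case: (@arg_maxnP _ v0 (mem p) depth v0p) => v /= vp max_v.
have [_ eq_next] : v != h /\ next p v = par v.
  apply: (rooted_adj_depth Gr); first exact: next_cycle cyc_p vp.
  by apply: max_v; rewrite /= mem_next.
have [_ eq_prev] : v != h /\ prev p v = par v.
  apply: (rooted_adj_depth Gr); first by rewrite adjC; apply: prev_cycle cyc_p vp.
  by apply: max_v; rewrite /= mem_prev.
have next_u : next p (par v) = v by rewrite -eq_prev next_prev.
have [i s rot_p] := rot_to vp.
have uniq_s : uniq (v :: s) by rewrite -rot_p rot_uniq.
have sz_s : 2 < size (v :: s) by rewrite -rot_p size_rot.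
rewrite -(next_rot i) // rot_p in eq_next.
rewrite -(next_rot i) // rot_p -eq_next in next_u.
case: s uniq_s sz_s next_u {rot_p eq_next} => [|u [|w s]] // uniq_s _ /=.
rewrite !eqxx; move: uniq_s; rewrite /= !inE !negb_or => /andP[/and3P[nvu nvw _] _].
by rewrite eq_sym (negPf nvu) => eq_w; rewrite eq_w eqxx in nvw.
Qed.

Lemma rooted_connect (G : sgraph) (h : G) par depth (x y : G) :
  rooted h par depth -> connect adj x y.
Proof.
move=> Gr; have conn_h v : connect adj v h.
  move: v; apply: (rooted_ind Gr) => [|v nv]; first exact: connect0.
  exact: connect_trans (connect1 (rooted_adj_par Gr nv)).
apply: connect_trans (conn_h x) _.
by rewrite (sym_connect_sym (@adj_sym G)).
Qed.

Lemma connected_setTP (G : sgraph) :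
  connected_set [set: G] <-> (exists h : G, True) /\ (forall x y : G, connect adj x y).
Proof.
have eq_ind : induced [set: G] =2 adj by move=> x y; rewrite /induced /= !in_setT.
split.
  case/andP=> /set0Pn[h _] conn; split=> [|x y]; first by exists h.
  move/forall_inP/(_ x (in_setT _))/forall_inP/(_ y (in_setT _)): conn.
  by rewrite (eq_connect eq_ind).
case=> [[h _] conn]; apply/andP; split; first by apply/set0Pn; exists h.
by do 2!apply/forall_inP=> ? _; rewrite (eq_connect eq_ind).
Qed.

Lemma rooted_tree (G : sgraph) (h : G) par depth : @rooted G h par depth -> tree G.
Proof.
move=> Gr; split; last exact: rooted_acyclic Gr.
by apply/connected_setTP; split=> [|x y]; [exists h | apply: rooted_connect Gr].
Qed.

Section Dist.
Variables (G : sgraph) (conn : forall x y : G, connect adj x y).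

Fixpoint walk k (x y : G) :=
  if k is k'.+1 then [exists z, walk k' x z && adj z y] else x == y.

Lemma ex_walk x y : exists k, walk k x y.
Proof.
have /connectP[p xp ->] := conn x y; exists (size p).
elim/last_ind: p xp => [|p z IH] //=; rewrite rcons_path last_rcons size_rcons.
by case/andP=> /IH wp pz; apply/existsP; exists (last x p); exact/andP.
Qed.

Definition dist x y := ex_minn (ex_walk x y).

Lemma dist_le k x y : walk k x y -> dist x y <= k.
Proof. by rewrite /dist; case: ex_minnP => m _; apply. Qed.

Lemma dist_walk x y : walk (dist x y) x y.
Proof. by rewrite /dist; case: ex_minnP. Qed.

Lemma dist0 x : dist x x = 0.
Proof. by apply/eqP; rewrite -leqn0 dist_le /=. Qed.

Lemma dist_adj x y z : adj y z -> dist x z <= (dist x y).+1.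
Proof.
move=> yz; apply: dist_le; apply/existsP; exists y.
by apply/andP; split; first exact: dist_walk.
Qed.

Lemma dist_pred x y : y != x ->
  exists z, adj z y && (dist x y == (dist x z).+1).
Proof.
move=> nyx; have := dist_walk x y; case eq_d: (dist x y) => [|d] /=.
  by move/eqP=> eq_xy; rewrite eq_xy eqxx in nyx.
case/existsP=> z /andP[wz zy]; exists z; rewrite zy eqn_leq !ltnS (dist_le wz) andbT /=.
by rewrite -ltnS -eq_d dist_adj.
Qed.

Definition toward (h v : G) : G :=
  odflt h [pick z | adj z v && (dist h v == (dist h z).+1)].

Lemma towardP h v : v != h ->
  adj (toward h v) v /\ dist h v = (dist h (toward h v)).+1.
Proof.
move=> nv; rewrite /toward; case: pickP => [z /andP[zv /eqP] //|no].
by have [z] := dist_pred nv; rewrite no.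
Qed.

(** Without the edge [xy] every vertex still reaches [h] through its parents; an
    edge [xy] that is not of parent type would thus close a cycle. *)
Lemma toward_edge h x y : acyclic G -> adj x y ->
  (x != h) && (toward h x == y) || (y != h) && (toward h y == x).
Proof.
move=> acyc xy; apply/negPn/negP; rewrite negb_or !negb_and !negbK => /andP[nx ny].
pose e := [rel a b : G | adj a b && ~~ ((a == x) && (b == y) || (a == y) && (b == x))].
have sym_e : symmetric e 
  by move=> a b; rewrite /= adjC orbC; congr (_ && ~~ (_ || _)); apply: andbC.
have conn_h v : connect e v h.
  have [n] := ubnP (dist h v); elim: n v => // n IHn v lt_n.
  have [->|nv] := eqVneq v h; first exact: connect0.
  have [adj_v dist_v] := towardP nv.
  apply: connect_trans (IHn (toward h v) _); last by rewrite -ltnS -dist_v.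
  apply: connect1; rewrite /= adjC adj_v negb_or /=.
  apply/andP; split; apply/negP=> /andP[/eqP eq_v eq_t].
    by move: nx nv; rewrite -eq_v => /orP[->|]; rewrite ?eq_t.
  by move: ny nv; rewrite -eq_v => /orP[->|]; rewrite ?eq_t.
have : connect e x y.
  by apply: connect_trans (conn_h x) _; rewrite (sym_connect_sym sym_e).
case/connectP=> p0 /shortenP[p path_p uniq_p _] last_p.
have path_adj : path adj x p by apply: sub_path path_p => a b /= /andP[].
apply: (acyc (x :: p)); last first.
  by rewrite /ucycle uniq_p andbT /= rcons_path path_adj -last_p adjC.
case: p path_p last_p {uniq_p path_adj} => [|a [|b p]] //=.
  by move=> _ eq_y; rewrite eq_y adj_irrefl in xy.
by move=> + eq_y; rewrite eq_y !eqxx andbF.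
Qed.

Lemma dist_rooted h : acyclic G -> rooted h (toward h) (dist h).
Proof.
move=> acyc; split=> [|||x y].
- rewrite /toward; case: pickP => // z /andP[_]; by rewrite dist0.
- exact: dist0.
- by move=> v /towardP[].
apply/idP/orP=> [/(toward_edge h acyc)/orP//|].
by case=> /andP[/towardP[+ _] /eqP <-]; rewrite 1?adjC.
Qed.

End Dist.

(** * Counting subtrees of a rooted tree *)

Section Rooted.
Variables (G : sgraph) (h : G) (par : G -> G) (depth : G -> nat).
Hypothesis Gr : rooted h par depth.
Implicit Types (c v x t : G) (cs : seq G) (S U : {set G}).

Definition children c := enum [pred v | (v != h) && (par v == c)].

Definition below c : {set G} := [set v | fconnect par v c].
Definition belows cs : {set G} := [set v | has (fun c => v \in below c) cs].

(** Inductions run through the list of children of a vertex, and so they concern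
    lists of some of the children rather than of all of them. *)
Definition siblings x cs := uniq cs && all (fun c => (c != h) && (par c == x)) cs.

Lemma mem_children c v : (v \in children c) = (v != h) && (par v == c).
Proof. by rewrite mem_enum. Qed.

Lemma siblings_children c : siblings c (children c).
Proof. by rewrite /siblings enum_uniq; apply/allP=> v; rewrite mem_children. Qed.

Lemma siblings_consP x c cs : siblings x (c :: cs) ->
  [/\ c != h, par c = x, c \notin cs & siblings x cs].
Proof.
by rewrite /siblings /= => /andP[/andP[-> ->] /andP[/andP[-> /eqP ->] ->]].
Qed.

Lemma siblings_mem x cs c : siblings x cs -> c \in cs -> c != h /\ par c = x.
Proof. by case/andP=> _ /allP sib /sib /andP[-> /eqP]. Qed.

Lemma siblings_depth x cs c : siblings x cs -> c \in cs -> depth c = (depth x).+1.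
Proof. by move=> sib /(siblings_mem sib)[nc <-]; apply: (depth_par Gr). Qed.

Lemma below_refl c : c \in below c.
Proof. by rewrite inE connect0. Qed.

Lemma below_par c v : v != c -> (v \in below c) = (v != h) && (par v \in below c).
Proof.
move=> nvc; rewrite !inE; apply/idP/idP=> [/connectP[[|w p] /=] | /andP[_]].
- by move=> _ eq_c; rewrite eq_c eqxx in nvc.
- case/andP=> /eqP eq_w path_p eq_c; apply/andP; split; last first.
    by apply/connectP; exists p; rewrite eq_w.
  apply: contraNneq nvc => eq_v; rewrite eq_c.
  have {}eq_w : w = h by rewrite -eq_w eq_v (par_root Gr).
  rewrite eq_v; elim: p w eq_w path_p {eq_c} => [|a p IH] w -> //=.
  by rewrite (par_root Gr) => /andP[/eqP <-]; apply: IH.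
- exact/connect_trans/connect1/eqxx.
Qed.

Lemma below_depth c v : v \in below c -> depth c <= depth v.
Proof.
move: v; apply: (rooted_ind Gr) => [|v nv IH].
  by have [->//|/below_par->] := eqVneq h c; rewrite eqxx.
have [->//|nvc] := eqVneq v c.
by rewrite below_par // (depth_par Gr nv) nv /= => /IH; apply: leqW.
Qed.

Lemma below_depth_eq c v : v \in below c -> depth v <= depth c -> v = c.
Proof.
have [//|nvc] := eqVneq v c; rewrite below_par // => /andP[nv /below_depth].
by rewrite (depth_par Gr nv); lia.
Qed.

Lemma belowsP cs v : reflect (exists2 c, c \in cs & v \in below c) (v \in belows cs).
Proof. by rewrite inE; apply: hasP. Qed.

Lemma below_root v : v \in below h.
Proof.
move: v; apply: (rooted_ind Gr) => [|v nv IH]; first exact: below_refl.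
by rewrite below_par ?nv.
Qed.

Lemma belows_children c v : (v \in belows (children c)) = (v \in below c) && (v != c).
Proof.
move: v; apply: (rooted_ind Gr) => [|v nv IH].
  have [<-|nhc] := eqVneq h c; last rewrite below_par ?eqxx //=.
    rewrite andbF; apply/belowsP=> [[c']]; rewrite mem_children => /andP[nc' _].
    by rewrite below_par 1?eq_sym // eqxx.
  apply/belowsP=> [[c']]; rewrite mem_children => /andP[nc' _].
  by rewrite below_par 1?eq_sym // eqxx.
have [->|nvc] := eqVneq v c.
  rewrite andbF; apply/belowsP=> [[c']]; rewrite mem_children => /andP[nc' /eqP pc'].
  by move/below_depth; rewrite (depth_par Gr nc') pc' ltnn.
rewrite andbT below_par // nv /=.
apply/belowsP/idP=> [[c' cc' v_c']|].
  have [eq_v|nvc'] := eqVneq v c'.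
    by move: cc'; rewrite -eq_v mem_children nv => /= /eqP->; apply: below_refl.
  move: v_c'; rewrite below_par // nv => /= pv.
  have : par v \in belows (children c) by apply/belowsP; exists c'.
  by rewrite IH => /andP[].
have [eq_pv _|npv pv] := eqVneq (par v) c.
  by exists v; rewrite ?below_refl // mem_children nv eq_pv eqxx.
have : par v \in belows (children c) by rewrite IH pv.
case/belowsP=> c' cc' pvc'; exists c' => //.
by have [->|nvc'] := eqVneq v c'; rewrite ?below_refl // below_par // nv.
Qed.

Lemma belows_cons c cs : belows (c :: cs) = below c :|: belows cs.
Proof. by apply/setP=> v; rewrite in_setU ![v \in belows _]inE. Qed.

Lemma siblings_disjoint x c cs : siblings x (c :: cs) ->
  [disjoint below c & belows cs].
Proof.
case/siblings_consP=> nc pc ncs sib; rewrite disjoint_subset; apply/subsetP=> v vc.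
rewrite inE; apply/belowsP=> [[c' c'cs]]; move: v vc.
have ncc' : c != c' by apply: contraNneq ncs => ->.
have dep : depth c = depth c'.
  by rewrite (siblings_depth sib c'cs) (depth_par Gr nc) pc.
apply: (rooted_ind Gr) => [|v nv IH].
  by rewrite below_par 1?eq_sym // eqxx.
have [-> _ /below_depth_eq eq_c|nvc] := eqVneq v c.
  by rewrite eq_c ?dep // eqxx in ncc'.
have [-> /below_depth_eq eq_c|nvc'] := eqVneq v c'.
  by rewrite eq_c ?dep // eqxx in ncc'.
by rewrite below_par // [v \in below c']below_par // nv.
Qed.

Lemma sum_belows (g : G -> nat) x c cs : siblings x (c :: cs) ->
  \sum_(t in belows (c :: cs)) g t =
  g c + \sum_(t in belows (children c)) g t + \sum_(t in belows cs) g t.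
Proof.
move=> sib; rewrite belows_cons.
rewrite (eq_bigl [predU below c & belows cs]) => [|v]; last by rewrite !inE.
rewrite bigU /=; last exact: siblings_disjoint sib.
congr (_ + _); rewrite (bigD1 c) ?below_refl //=; congr (_ + _).
by apply: eq_bigl => v; rewrite belows_children.
Qed.

Definition height := (\max_(v : G) depth v).+1.

(** The fuel [k] is enough when it is the number of levels from [c] down. *)
Fixpoint unfold k c :=
  if k is k'.+1 then
    foldr (fun c' g => fcons (unfold k' c') g) fnil (children c)
  else fnil.

Definition subforest c := unfold (height - depth c) c.
Definition forest_of cs := foldr (fun c g => fcons (subforest c) g) fnil cs.

Lemma depth_lt_height v : depth v < height.
Proof. by rewrite ltnS; apply: leq_bigmax. Qed.

Lemma subforestE c : subforest c = forest_of (children c).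
Proof.
rewrite /subforest; case eq_k: (height - depth c) (depth_lt_height c) => [|k].
  by rewrite ltnNge -subn_eq0 eq_k.
move=> _ /=; have := siblings_children c; elim: (children c) => //= c' cs IH sib.
rewrite IH; last by case/siblings_consP: sib.
by rewrite /subforest (siblings_depth sib) ?mem_head // subnS eq_k.
Qed.

Lemma siblings_ind (P : seq G -> Prop) : P [::] ->
  (forall x c cs, siblings x (c :: cs) -> P (children c) -> P cs -> P (c :: cs)) ->
  forall x cs, siblings x cs -> P cs.
Proof.
move=> P0 PS x cs; have [n] := ubnP (height - depth x).
elim: n x cs => // n IHn x cs lt_n; elim: cs => // c cs IHcs sib.
have [nc pc _ sib'] := siblings_consP sib.
apply: PS (sib) _ (IHcs sib'); apply: IHn (siblings_children c).
have := depth_lt_height x; have := depth_lt_height c.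
by move: lt_n; rewrite (siblings_depth sib (mem_head _ _)); lia.
Qed.

Definition is_ideal cs S :=
  [forall v in S, (v \in cs) || (v != h) && (par v \in S)].
Definition num_ideals U cs := #|[set S | is_ideal cs S & S \subset U]|.

Lemma ideal_belows cs S : is_ideal cs S -> S \subset belows cs.
Proof.
move/forall_inP=> idS; apply/subsetP; apply: (rooted_ind Gr) => [|v nv IH] /idS.
  by rewrite eqxx orbF => hcs; apply/belowsP; exists h; rewrite ?below_refl.
case/orP=> [vcs|/andP[_ /IH/belowsP[c ccs pvc]]]; apply/belowsP.
  by exists v; rewrite ?below_refl.
by exists c => //; have [->|nvc] := eqVneq v c; rewrite ?below_refl // below_par // nv.
Qed.

Lemma num_ideals_nil U : num_ideals U [::] = 1.
Proof.
rewrite /num_ideals -(cards1 (@set0 G)); apply: eq_card => S; rewrite !inE.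
apply/andP/eqP=> [[/ideal_belows + _]|->]; last first.
  by rewrite sub0set; split=> //; apply/forall_inP=> v; rewrite inE.
move=> /subsetP sub; apply/eqP; rewrite -subset0; apply/subsetP=> v /sub.
by rewrite inE.
Qed.

(** An ideal either avoids [c], and then everything below [c], or consists of
    [c], an ideal below [c] and an ideal for the other siblings, chosen
    independently. *)
Lemma num_ideals_cons U x c cs : siblings x (c :: cs) ->
  num_ideals U (c :: cs) =
  ((c \in U) * num_ideals U (children c)).+1 * num_ideals U cs.
Proof.
move=> sib; have [nc pc ncs sib'] := siblings_consP sib.
have disj := siblings_disjoint sib.
set B1 := belows (children c); set B2 := belows cs.
have B1c : B1 \subset below c.
  by apply/subsetP=> v; rewrite belows_children => /andP[].
have cB1 : c \notin B1 by rewrite belows_children eqxx andbF.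
have below_not_B2 v : v \in below c -> v \notin B2.
  by move/(disjointFr disj) => ->.
have cB2 := below_not_B2 _ (below_refl c).
rewrite mulSn /num_ideals -(cardsID [set S : {set G} | c \notin S]); congr (_ + _).
  apply: eq_card => S; rewrite !inE -andbA; apply/and3P/andP.
    case=> /forall_inP idS -> ncS; split=> //; apply/forall_inP=> v vS.
    by have := idS v vS; rewrite inE; case: eqVneq vS ncS => //= -> ->.
  case=> idS subU; have ncS : c \notin S.
    by apply: contra cB2; apply/subsetP/ideal_belows.
  split=> //; apply/forall_inP=> v vS; rewrite inE.
  by move/forall_inP: idS => /(_ v vS) /orP[->|->]; rewrite ?orbT.
case: (boolP (c \in U)) => cU; last first.
  rewrite mul0n; apply: eq_card0 => S; rewrite !inE negbK.
  by apply/and3P=> [[cS _ /subsetP/(_ c cS)]]; apply/negP.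
rewrite mul1n -cardsX.
pose glue (p : {set G} * {set G}) := c |: (p.1 :|: p.2).
set I1 := [set S | is_ideal (children c) S & S \subset U].
set I2 := [set S | is_ideal cs S & S \subset U].
have I1B S : S \in I1 -> S \subset B1 by rewrite inE => /andP[/ideal_belows].
have I2B S : S \in I2 -> S \subset B2 by rewrite inE => /andP[/ideal_belows].
have inj : {in setX I1 I2 &, injective glue}.
  suff can S1 S2 : S1 \in I1 -> S2 \in I2 ->
      S1 = glue (S1, S2) :&: B1 /\ S2 = glue (S1, S2) :&: B2.
    move=> [S1 S2] [S1' S2'] /setXP[/= m1 m2] /setXP[/= m1' m2'] eq_gl.
    have [e1 e2] := can _ _ m1 m2; have [e1' e2'] := can _ _ m1' m2'.
    by congr pair; [rewrite e1 eq_gl -e1' | rewrite e2 eq_gl -e2'].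
  move=> /I1B/subsetP sub1 /I2B/subsetP sub2; split; apply/setP=> v;
    rewrite /glue /= in_setI in_setU1 in_setU.
    have [v1|nv1] := boolP (v \in B1); last by rewrite andbF; apply: contraNF nv1 => /sub1.
    have -> : v == c = false by apply: contraNF cB1 => /eqP <-.
    have -> : v \in S2 = false; last by rewrite orbF andbT.
    by apply: contraNF (below_not_B2 v _); [move/sub2|apply: (subsetP B1c)].
  have [v2|nv2] := boolP (v \in B2); last by rewrite andbF; apply: contraNF nv2 => /sub2.
  have -> : v == c = false by apply: contraNF cB2 => /eqP <-.
  have -> : v \in S1 = false; last by rewrite andbT.
  by apply: contraTF v2 => /sub1 /(subsetP B1c)/below_not_B2.
rewrite -(card_in_imset inj); apply: eq_card => S; rewrite !inE negbK.
apply/and3P/imsetP.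
  case=> cS idS subU; exists (S :&: B1, S :&: B2); last first.
    rewrite /glue -setIUr; apply/setP=> v; rewrite in_setU1 in_setI.
    case: eqVneq => [->//|nvc] /=; case vS: (v \in S) => //=.
    have := subsetP (ideal_belows idS) v vS; rewrite belows_cons !in_setU.
    by rewrite [v \in B1]belows_children nvc andbT => ->.
  rewrite in_setX ![_ \in I1]inE ![_ \in I2]inE !(subset_trans (subsetIl _ _) subU) !andbT.
  move/forall_inP: idS => idS; apply/andP; split; apply/forall_inP=> v.
    case/setIP=> vS vB1; have nvc : v != c by apply: contraNneq cB1 => <-.
    have vc := subsetP B1c v vB1.
    have := idS v vS; rewrite inE (negPf nvc) /=.
    have -> : v \in cs = false.
      apply: contraNF (below_not_B2 v vc) => vcs; apply/belowsP.
      by exists v; rewrite ?below_refl.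
    case/andP=> nv pvS; rewrite mem_children nv /= in_setI pvS /= belows_children.
    by move: vc; rewrite below_par // nv /= => ->; case: eqVneq.
  case/setIP=> vS vB2; have nvc : v != c by apply: contraNneq cB2 => <-.
  have := idS v vS; rewrite inE (negPf nvc) /= => /orP[->//|/andP[nv pvS]].
  case/belowsP: vB2 => c' c'cs vc'.
  have [->|nvc'] := eqVneq v c'; first by rewrite c'cs.
  rewrite nv in_setI pvS /=; apply/orP; right; apply/belowsP; exists c' => //.
  by move: vc'; rewrite below_par // nv.
case=> [[S1 S2]]; rewrite in_setX !inE /= => /andP[/andP[id1 sub1] /andP[id2 sub2]] ->.
split; rewrite /glue /=; first by rewrite setU11.
  move/forall_inP: id1 => id1; move/forall_inP: id2 => id2.
  apply/forall_inP=> v; rewrite /is_ideal !in_setU !in_set1 => /or3P[/eqP->|v1|v2].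
  - by rewrite mem_head.
    have := id1 v v1; rewrite mem_children; case/orP=> /andP[-> pv].
      by rewrite pv /= orbT.
    by rewrite pv !orbT.
  by have := id2 v v2; rewrite inE; case/orP=> [->|/andP[-> ->]]; rewrite !orbT.
by rewrite !subUset sub1set cU sub1.
Qed.


(** [S] is a subtree and [t] is its vertex closest to the root. *)
Definition subtree_at t S :=
  (t \in S) && [forall v in S, (v == t) || (v != h) && (par v \in S)].

Lemma subtree_at_below t S : subtree_at t S -> S \subset below t.
Proof.
case/andP=> tS /forall_inP top; apply/subsetP; apply: (rooted_ind Gr) => [|v nv IH].
  by move/top; rewrite eqxx orbF => /eqP->; apply: below_refl.
have [->|nvt] := eqVneq v t; first by rewrite below_refl.
by move/top; rewrite (negPf nvt) nv /= => /IH; rewrite (below_par nvt) nv.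
Qed.

Lemma subtree_at_inj t t' S : subtree_at t S -> subtree_at t' S -> t = t'.
Proof.
move=> top top'; have [tS _] := andP top; have [t'S _] := andP top'.
apply: below_depth_eq; first exact: subsetP (subtree_at_below top') _ tS.
by apply: below_depth; apply: subsetP (subtree_at_below top) _ t'S.
Qed.

Lemma subtree_at_connected t S : subtree_at t S -> connected_set S.
Proof.
case/andP=> tS /forall_inP top.
have sym_i : symmetric (induced S) by move=> x y; rewrite /induced /= adjC andbCA.
have conn v : v \in S -> connect (induced S) v t.
  move: v; apply: (rooted_ind Gr) => [|v nv IH] vS.
    by have := top _ vS; rewrite eqxx orbF => /eqP->; apply: connect0.
  have [->|nvt] := eqVneq v t; first exact: connect0.
  have := top _ vS; rewrite (negPf nvt) nv /= => pS.
  apply: connect_trans (IH pS); apply: connect1.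
  by rewrite /induced /= vS pS (rooted_adj_par Gr nv).
apply/andP; split; first by apply/set0Pn; exists t.
apply/forall_inP=> x xS; apply/forall_inP=> y yS.
by apply: connect_trans (conn x xS) _; rewrite (sym_connect_sym sym_i) conn.
Qed.

(** The top is a vertex [t] of least depth. If another vertex [v] of [S] lacked
    its parent in [S], no edge inside [S] would leave the descendants of [v], and
    [t] is not among them. *)
Lemma connected_subtree_at S : connected_set S -> exists t, subtree_at t S.
Proof.
case/andP=> /set0Pn[v0 v0S] /forall_inP conn.
case: (@arg_minnP _ v0 (mem S) depth v0S) => t /= tS min_t; exists t.
apply/andP; split=> //; apply/forall_inP=> v vS; apply/norP=> [[nvt]].
rewrite negb_and negbK => out.
have nt_v : t \notin below v.
  by apply: contra nvt => /below_depth_eq-> //; apply: min_t.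
have nvh : v != h by apply: contraNneq nt_v => ->; apply: below_root.
rewrite (negPf nvh) /= in out.
have sym_i : connect_sym (induced S).
  by apply: sym_connect_sym => x y; rewrite /induced /= adjC andbCA.
have closed_v : closed (induced S) (mem (below v)).
  apply: intro_closed => // x y /and3P[xS yS].
  rewrite (adj_par Gr) => /orP[/andP[nx /eqP eq_y] xv|/andP[ny /eqP eq_x] xv].
    have [eq_v|nxv] := eqVneq x v; first by rewrite -eq_v eq_y yS in out.
    by move: xv; rewrite below_par // nx eq_y.
  have [->|nyv] := eqVneq y v; first exact: below_refl.
  by rewrite /= below_par // ny eq_x.
have /forall_inP/(_ v vS) := conn t tS.
by move/(closed_connect closed_v); rewrite /= below_refl (negPf nt_v).
Qed.

Lemma sum_subtree_at S : \sum_t (subtree_at t S : nat) = connected_set S.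
Proof.
have [conn|nconn] := boolP (connected_set S); last first.
  rewrite big1 // => t _; apply/eqP; rewrite eqb0.
  by apply: contra nconn; apply: subtree_at_connected.
have [t top] := connected_subtree_at conn.
rewrite (bigD1 t) //= top big1 // => t' nt; apply/eqP; rewrite eqb0.
by apply: contra nt => /(subtree_at_inj top)->.
Qed.

Lemma root_notin_ideal t S : is_ideal (children t) S -> t \notin S.
Proof.
by move/ideal_belows/subsetP=> sub; apply/negP=> /sub; rewrite belows_children eqxx andbF.
Qed.

Lemma subtree_at_ideal t S : t \notin S ->
  subtree_at t (t |: S) = is_ideal (children t) S.
Proof.
move=> tS; rewrite /subtree_at setU11 /=; apply/forall_inP/forall_inP=> top v vS.
  have nvt : v != t by apply: contraNneq tS => <-.
  have := top v; rewrite in_setU1 vS orbT (negPf nvt) => /(_ isT)/andP[nv].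
  by rewrite mem_children nv in_setU1 => /orP[->|->]; rewrite ?orbT.
move: vS; rewrite in_setU1 => /orP[->//|/top].
by rewrite mem_children in_setU1 => /orP[/andP[-> ->]|/andP[-> ->]]; rewrite ?orbT.
Qed.

Lemma card_subtree_at U t :
  #|[set S | subtree_at t S & S \subset U]| = (t \in U) * num_ideals U (children t).
Proof.
have [tU|ntU] := boolP (t \in U); last first.
  apply: eq_card0 => S; rewrite inE; apply/negP=> /andP[/andP[tS _] /subsetP/(_ t tS)].
  exact/negP.
rewrite mul1n /num_ideals; set I := [set S | is_ideal (children t) S & _].
have nt S : S \in I -> t \notin S by rewrite inE => /andP[idS _]; apply: root_notin_ideal.
have inj : {in I &, injective (fun S => t |: S)}.
  by move=> S S' /nt tS /nt tS' eqS; rewrite -(setU1K tS) eqS setU1K.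
rewrite -(card_in_imset inj); apply: eq_card => S; rewrite inE.
apply/andP/imsetP=> [[top subU]|[S' I_S' ->]].
  have tS : t \in S by case/andP: top.
  exists (S :\ t); last by rewrite setD1K.
  rewrite inE -subtree_at_ideal ?setD11 // setD1K // top.
  by rewrite (subset_trans (subsetDl _ _) subU).
have tS' := nt _ I_S'; move: I_S'; rewrite inE subtree_at_ideal // => /andP[-> sub].
by rewrite subUset sub1set tU.
Qed.

Lemma card_connected U : #|[set S | connected_set S & S \subset U]| =
  \sum_t (t \in U) * num_ideals U (children t).
Proof.
under eq_bigr => t _ do rewrite -card_subtree_at -sum1_card.
rewrite -sum1_card big_mkcond /=.
under [RHS]eq_bigr => t _ do rewrite big_mkcond /=.
rewrite exchange_big /=; apply: eq_bigr => S _; rewrite inE.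
under eq_bigr => t _ do rewrite inE.
have [subU|nsub] := boolP (S \subset U).
  under eq_bigr => t _ do rewrite andbT -[(if _ then _ else _)]/(nat_of_bool _).
  by rewrite sum_subtree_at andbT; case: connected_set.
by rewrite andbF big1 // => t _; rewrite andbF.
Qed.

Lemma degreeE v : degree v = size (children v) + (v != h).
Proof.
rewrite /degree -cardE; have [->|nv] := eqVneq v h.
  by rewrite addn0; apply: eq_card => w; rewrite !inE (adj_par Gr) eqxx.
rewrite (cardsD1 (par v)) inE (rooted_adj_par Gr nv) addnC; congr (_ + _).
apply: eq_card => w; rewrite !inE (adj_par Gr) nv /= (eq_sym (par v)).
case: eqVneq => [->|_] //=; case: eqVneq => //= npv; apply/esym/eqP=> eq_v.
by move: (depth_par Gr nv); rewrite (depth_par Gr npv) eq_v; lia.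
Qed.

Lemma leaf_children v : v != h -> leaf v = (children v == [::]).
Proof. by move=> nv; rewrite /leaf degreeE nv addn1 eqSS size_eq0. Qed.

Lemma is_nil_forest cs : is_nil (forest_of cs) = (cs == [::]).
Proof. by case: cs. Qed.

Lemma siblings_neq_root x c cs : siblings x (c :: cs) -> c != h.
Proof. by case/siblings_consP. Qed.

Lemma num_idealsT x cs : siblings x cs -> num_ideals [set: G] cs = ideals (forest_of cs).
Proof.
move: x cs; apply: siblings_ind => [|x c cs sib IHc IHcs]; first exact: num_ideals_nil.
by rewrite (num_ideals_cons _ sib) in_setT mul1n IHc IHcs /= subforestE.
Qed.

Definition nonleaves : {set G} := [set v | ~~ leaf v].

Lemma num_ideals_inner x cs : siblings x cs ->
  num_ideals nonleaves cs = inner_ideals (forest_of cs).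
Proof.
move: x cs; apply: siblings_ind => [|x c cs sib IHc IHcs]; first exact: num_ideals_nil.
rewrite (num_ideals_cons _ sib) IHc IHcs /= -subforestE inE.
rewrite leaf_children ?(siblings_neq_root sib) //.
by rewrite subforestE is_nil_forest.
Qed.

Lemma card_belows_forest x cs : siblings x cs -> #|belows cs| = fsize (forest_of cs).
Proof.
move: x cs; apply: siblings_ind => [|x c cs sib IHc IHcs].
  by apply: eq_card0 => v; rewrite inE.
by rewrite -sum1_card (sum_belows _ sib) !sum1_card IHc IHcs /= subforestE -addSn add1n.
Qed.

Lemma sum_leafy x cs : siblings x cs ->
  \sum_(t in belows cs) (ideals (subforest t) - (t \in nonleaves) * inner_ideals (subforest t))
  = leafy (forest_of cs).
Proof.
move: x cs; apply: siblings_ind => [|x c cs sib IHc IHcs].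
  by apply: big1 => t; rewrite inE.
rewrite (sum_belows _ sib) IHc IHcs /= -subforestE inE.
rewrite leaf_children ?(siblings_neq_root sib) //.
by rewrite !subforestE is_nil_forest; congr (_ + _); apply: addnC.
Qed.

Lemma belows_root : belows (children h) = [set~ h].
Proof. by apply/setP=> v; rewrite belows_children below_root !inE. Qed.

Lemma card_rooted : #|G| = (fsize (forest_of (children h))).+1.
Proof.
rewrite -(card_belows_forest (siblings_children h)) belows_root.
rewrite -cardsT (cardsD1 h) in_setT add1n; congr _.+1.
by apply: eq_card => v; rewrite !inE andbT.
Qed.

(** Subtrees containing a leaf are all subtrees minus those inside the set of
    nonleaves; each family is counted by tops, and the top [h] is separated
    from the others. *)
Lemma FstarE : ~~ leaf h ->
  Fstar G = leafy (forest_of (children h)) +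
    (ideals (forest_of (children h)) - inner_ideals (forest_of (children h))).
Proof.
move=> nlh; have -> : Fstar G = #|[set S | connected_set S & S \subset [set: G]]|
    - #|[set S | connected_set S & S \subset nonleaves]|.
  rewrite -(cardsID [set S : {set G} | S \subset nonleaves]
    [set S | connected_set S & S \subset setT]).
  rewrite (_ : _ :&: _ = [set S | connected_set S & S \subset nonleaves]); last first.
    by apply/setP=> S; rewrite !inE subsetT andbT.
  rewrite addKn; apply: eq_card => S; rewrite !inE subsetT andbT andbC; congr (_ && _).
  apply/exists_inP/subsetPn=> [] [v vS lv]; exists v => //; first by rewrite inE negbK.
  by move: lv; rewrite inE negbK.
rewrite !card_connected -sumnB => [|t _].
  rewrite (bigD1 h) //= addnC; congr (_ + _).
    rewrite -(sum_leafy (siblings_children h)); apply: eq_big => t.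
      by rewrite belows_root !inE.
    move=> _; rewrite in_setT mul1n (num_idealsT (siblings_children t)).
    by rewrite (num_ideals_inner (siblings_children t)) -subforestE.
  rewrite in_setT mul1n (num_idealsT (siblings_children h)) inE nlh mul1n.
  by rewrite (num_ideals_inner (siblings_children h)).
rewrite in_setT mul1n (num_idealsT (siblings_children t)).
rewrite (num_ideals_inner (siblings_children t)).
case: (dominated_forest (forest_of (children t))) => [[_ le_i _ _] _ _].
by apply: leq_trans le_i; case: (_ \in _); rewrite ?mul1n.
Qed.

(** * Leaves and legs *)

Lemma sum_leaves_forest x cs : siblings x cs ->
  \sum_(t in belows cs) (leaf t : nat) = size (path_lengths (forest_of cs)).
Proof.
move: x cs; apply: siblings_ind => [|x c cs sib IHc IHcs].
  by apply: big1 => t; rewrite inE.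
rewrite (sum_belows _ sib) IHc IHcs /= size_cat leaf_children ?(siblings_neq_root sib) //.
congr (_ + _); rewrite subforestE -is_nil_forest -path_lengths_nil.
by case: (path_lengths _).
Qed.

Lemma sum_non_root (g : G -> nat) : \sum_t g t = g h + \sum_(t in belows (children h)) g t.
Proof.
by rewrite (bigD1 h) //=; congr (_ + _); apply: eq_bigl => t; rewrite belows_root !inE.
Qed.

Lemma card_leaves : ~~ leaf h -> #|leaves G| = size (path_lengths (forest_of (children h))).
Proof.
move=> nlh; rewrite -(sum_leaves_forest (siblings_children h)) -sum1_card big_mkcond /=.
rewrite sum_non_root inE (negPf nlh); apply: eq_bigr => t _; rewrite inE.
by case: (leaf t).
Qed.

Lemma count_leaf_depths x cs d : siblings x cs -> unbranched (forest_of cs) ->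
  \sum_(t in belows cs) (leaf t && (depth t == d) : nat)
  = count (fun p => depth x + p == d) (path_lengths (forest_of cs)).
Proof.
move=> sib0; suff: forall y, siblings y cs -> unbranched (forest_of cs) ->
  \sum_(t in belows cs) (leaf t && (depth t == d) : nat)
  = count (fun p => depth y + p == d) (path_lengths (forest_of cs)).
  by move=> gen; apply: gen sib0.
move: x cs sib0; apply: siblings_ind => [|x c cs sib IHc IHcs] y siby.
  by move=> _; apply: big1 => t; rewrite inE.
have [nc pc _ sib'] := siblings_consP siby.
have dc := siblings_depth siby (mem_head _ _).
move=> /= /and3P[short ubc ubcs].
rewrite (sum_belows _ sib) (IHcs _ sib' ubcs) count_cat leaf_children //.
congr (_ + _); rewrite subforestE in short ubc *.
rewrite (IHc _ (siblings_children c) ubc) dc.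
rewrite (path_lengths_unbranched ubc).
case: (children c) short => [|c' [|? ?]] //= _; first by rewrite addn1 addn0.
by rewrite addSnnS.
Qed.

(** This links the path lengths of the forest with the legs in the sense of [leg]:
    the length of a leg is the depth of the leaf at its end. *)
Lemma perm_leaf_depths : ~~ leaf h -> unbranched (forest_of (children h)) ->
  perm_eq [seq depth v | v <- enum (leaves G)] (path_lengths (forest_of (children h))).
Proof.
move=> nlh ub; apply/allP=> d _ /=; apply/eqP; rewrite count_map.
have := count_leaf_depths d (siblings_children h) ub; rewrite (depth_root Gr) => <-.
rewrite -sum1_count big_enum_cond /=.
rewrite big_mkcond sum_non_root inE (negPf nlh); apply: eq_bigr => t _; rewrite inE.
by case: (leaf t); case: eqP.
Qed.

(** The vertices from [h] to [v], without [h], as in [leg]. *)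
Definition root_path v := rev (traject par v (depth v)).

Lemma root_path_root : root_path h = [::].
Proof. by rewrite /root_path (depth_root Gr). Qed.

Lemma root_path_par v : v != h -> root_path v = rcons (root_path (par v)) v.
Proof. by move=> nv; rewrite /root_path (depth_par Gr nv) trajectS rev_cons. Qed.

Lemma size_root_path v : size (root_path v) = depth v.
Proof. by rewrite size_rev size_traject. Qed.

Lemma last_root_path v : last h (root_path v) = v.
Proof.
have [->|nv] := eqVneq v h; first by rewrite root_path_root.
by rewrite root_path_par // last_rcons.
Qed.

Lemma path_root_path v : path adj h (root_path v) /\ uniq (h :: root_path v).
Proof.
suff: [/\ path adj h (root_path v), uniq (h :: root_path v) &
          all (fun w => depth w <= depth v) (h :: root_path v)] by case.
move: v; apply: (rooted_ind Gr) => [|v nv [path_v uniq_v dep_v]].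
  by rewrite root_path_root /= leqnn.
rewrite root_path_par // rcons_path path_v last_root_path -rcons_cons rcons_uniq.
rewrite adjC (rooted_adj_par Gr nv) uniq_v andbT all_rcons leqnn (depth_par Gr nv).
split=> //; last by apply: sub_all dep_v => w; apply: leqW.
by rewrite andbT; apply/negP=> v_in; have := allP dep_v v v_in; rewrite (depth_par Gr nv) ltnn.
Qed.

(** A path from the root that does not repeat vertices can never turn upwards. *)
Lemma uniq_path_root p : path adj h p -> uniq (h :: p) -> p = root_path (last h p).
Proof.
elim/last_ind: p => [|p z IH]; first by rewrite root_path_root.
rewrite rcons_path last_rcons -rcons_cons rcons_uniq.
case/andP=> path_p yz /andP[z_notin uniq_p]; have {IH} := IH path_p uniq_p.
move: yz; set y := last h p => yz eq_p.
move: yz; rewrite (adj_par Gr) => /orP[/andP[ny /eqP eq_z]|/andP[nz /eqP eq_y]]; last first.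
  by rewrite root_path_par // eq_y -eq_p.
case/negP: z_notin; rewrite eq_p root_path_par // -rcons_cons mem_rcons inE -eq_z.
by apply/orP; right; rewrite -{1}[par y]last_root_path mem_last.
Qed.

Lemma legP p : reflect (exists2 v, leaf v & p = root_path v) (leg h p).
Proof.
apply: (iffP and3P) => [[path_p uniq_p leaf_p]|[v leaf_v ->]].
  by exists (last h p); rewrite // -uniq_path_root.
by have [-> ->] := path_root_path v; rewrite last_root_path.
Qed.

Lemma perm_legs (legs : seq (seq G)) :
  uniq legs -> (forall p, (p \in legs) = leg h p) ->
  perm_eq legs [seq root_path v | v <- enum (leaves G)].
Proof.
move=> uniq_l mem_l; apply: uniq_perm => // [|p].
  by rewrite map_inj_uniq ?enum_uniq //; apply: can_inj last_root_path.
rewrite mem_l; apply/legP/mapP=> [[v lv ->]|[v]]; first by exists v; rewrite ?mem_enum ?inE.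
by rewrite mem_enum inE => lv ->; exists v.
Qed.

Lemma perm_leg_sizes (legs : seq (seq G)) :
  uniq legs -> (forall p, (p \in legs) = leg h p) ->
  perm_eq (map size legs) [seq depth v | v <- enum (leaves G)].
Proof.
move=> uniq_l mem_l.
have -> : [seq depth v | v <- enum (leaves G)]
        = map size [seq root_path v | v <- enum (leaves G)].
  by rewrite -map_comp; apply: eq_map => v /=; rewrite size_root_path.
exact/perm_map/perm_legs.
Qed.

Lemma hub_unbranched x cs : hub h -> siblings x cs -> unbranched (forest_of cs).
Proof.
move=> hub_h; move: x cs; apply: siblings_ind => // x c cs sib ubc ubcs.
rewrite /= subforestE ubc ubcs !andbT.
have nc := siblings_neq_root sib.
have : size (children c) <= 1.
  have : ~~ (2 < degree c) by apply: contra nc => /hub_h->.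
  by rewrite degreeE nc; lia.
by case: (children c) => [|c' []].
Qed.

(** Sorting the branches at the root by size gives spiders with the same leg
    lengths the same forest. *)
Definition sorted_children :=
  sort (relpre (fun c => fsize (subforest c)) leq) (children h).

Lemma branch_sizes_forest cs :
  branch_sizes (forest_of cs) = [seq (fsize (subforest c)).+1 | c <- cs].
Proof. by elim: cs => //= c cs ->. Qed.

Lemma perm_sorted_children : perm_eq sorted_children (children h).
Proof. by rewrite perm_sort. Qed.

Lemma siblings_sorted : siblings h sorted_children.
Proof.
rewrite /siblings (perm_uniq perm_sorted_children) (perm_all _ perm_sorted_children).
exact: siblings_children.
Qed.

Lemma unbranched_forest cs : unbranched (forest_of cs) =
  all (fun c => (is_nil (subforest c) || is_single (subforest c)) &&
                unbranched (subforest c)) cs.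
Proof. by elim: cs => //= c cs ->; rewrite andbA. Qed.

Lemma sorted_forest : unbranched (forest_of (children h)) ->
  forest_of sorted_children = chains (sort leq (path_lengths (forest_of (children h)))).
Proof.
move=> ub; have ub' : unbranched (forest_of sorted_children).
  by rewrite unbranched_forest (perm_all _ perm_sorted_children) -unbranched_forest.
rewrite {1}(unbranched_chains ub') (path_lengths_unbranched ub) !branch_sizes_forest.
congr chains; rewrite sort_map; congr map; apply: eq_sort => x y /=.
Qed.

End Rooted.

(** * Isomorphism from equality of shapes *)

Lemma mem_zip (S T : eqType) (s : seq S) (t : seq T) u w :
  (u, w) \in zip s t -> u \in s /\ w \in t.
Proof.
elim: s t => [|a s IH] [|b t] //; rewrite /= !inE => /orP[/eqP[-> ->]|/IH[-> ->]].
  by rewrite !eqxx.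
by rewrite !orbT.
Qed.

Lemma unzip_pair (S T : eqType) (Z : seq (S * T)) t0 u w :
  uniq (unzip1 Z) -> (u, w) \in Z -> nth t0 (unzip2 Z) (index u (unzip1 Z)) = w.
Proof.
elim: Z => //= [[a b] Z IH] /= /andP[na uZ]; rewrite inE => /orP[/eqP[<- <-]|uw].
  by rewrite eqxx.
case: eqVneq na => [->|_ _]; last exact: IH.
by case/negP; apply/mapP; exists (u, w).
Qed.

Section Isomorphism.
Variables (G G' : sgraph) (h : G) (par : G -> G) (depth : G -> nat).
Variables (h' : G') (par' : G' -> G') (depth' : G' -> nat).
Hypotheses (Gr : rooted h par depth) (Gr' : rooted h' par' depth').

(** A bijection between two sets of descendants, given by its graph [Z] as a list
    of pairs, which respects parents except at the corresponding entries of [cs]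
    and [cs']. *)
Definition matching cs cs' (Z : seq (G * G')) :=
  [/\ uniq (unzip1 Z), unzip1 Z =i belows par cs,
      uniq (unzip2 Z), unzip2 Z =i belows par' cs' &
      forall u w, (u, w) \in Z -> (u, w) \in zip cs cs' \/ (par u, par' w) \in Z].

Lemma ex_matching x cs x' cs' :
  siblings h par x cs -> siblings h' par' x' cs' ->
  forest_of h par depth cs = forest_of h' par' depth' cs' ->
  exists Z, matching cs cs' Z.
Proof.
move=> sib; move: x cs sib x' cs'.
apply: (siblings_ind Gr) => [|x c cs sib IHc IHcs] x' [|c' cs'] // sib'.
  by move=> _; exists [::]; split=> // v; rewrite !inE.
have [_ _ _ sibt'] := siblings_consP sib'.
case=> eq_c eq_cs; have [Z2 [u2 m2 u2' m2' p2]] := IHcs _ _ sibt' eq_cs.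
rewrite (subforestE Gr) (subforestE Gr') in eq_c.
have [Z1 [u1 m1 u1' m1' p1]] := IHc _ _ (siblings_children h' par' c') eq_c.
have disj := disjointFr (siblings_disjoint Gr sib).
have disj' := disjointFr (siblings_disjoint Gr' sib').
exists ((c, c') :: Z1 ++ Z2); split.
- rewrite /= /unzip1 map_cat mem_cat cat_uniq u1 u2 andbT negb_or m1 m2.
  rewrite (belows_children Gr) eqxx andbF (disj _ (below_refl par c)) /=.
  apply/hasPn=> v; rewrite m1 m2 (belows_children Gr) => v2.
  by apply: contraTN v2 => /andP[/disj-> _].
- move=> v; rewrite /= /unzip1 map_cat inE mem_cat m1 m2 belows_cons in_setU.
  rewrite (belows_children Gr) orbA; congr (_ || _).
  by case: eqVneq => [->|] /=; rewrite ?below_refl ?andbT.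
- rewrite /= /unzip2 map_cat mem_cat cat_uniq u1' u2' andbT negb_or m1' m2'.
  rewrite (belows_children Gr') eqxx andbF (disj' _ (below_refl par' c')) /=.
  apply/hasPn=> v; rewrite m1' m2' (belows_children Gr') => v2.
  by apply: contraTN v2 => /andP[/disj'-> _].
- move=> v; rewrite /= /unzip2 map_cat inE mem_cat m1' m2' belows_cons in_setU.
  rewrite (belows_children Gr') orbA; congr (_ || _).
  by case: eqVneq => [->|] /=; rewrite ?below_refl ?andbT.
move=> u w; rewrite inE mem_cat => /or3P[/eqP[-> ->]|/p1[uw|uw]|/p2[uw|uw]].
- by left; rewrite mem_head.
- have [] := mem_zip uw; rewrite !mem_children => /andP[_ /eqP->] /andP[_ /eqP->].
  by right; rewrite mem_head.
- by right; rewrite inE mem_cat uw orbT.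
- by left; rewrite /= inE uw orbT.
- by right; rewrite inE mem_cat uw !orbT.
Qed.

Lemma forest_giso cs cs' :
  siblings h par h cs -> siblings h' par' h' cs' ->
  perm_eq cs (children h par h) -> perm_eq cs' (children h' par' h') ->
  forest_of h par depth cs = forest_of h' par' depth' cs' -> giso G G'.
Proof.
move=> sib sib' pcs pcs' eq_f; have [Z [u1 m1 u2 m2 pZ]] := ex_matching sib sib' eq_f.
have b_cs : belows par cs = [set~ h].
  rewrite -(belows_root Gr); apply/setP=> v; rewrite !inE; exact: perm_has.
have b_cs' : belows par' cs' = [set~ h'].
  rewrite -(belows_root Gr'); apply/setP=> v; rewrite !inE; exact: perm_has.
pose Y := (h, h') :: Z.
have U1 : uniq (unzip1 Y) by rewrite /= u1 m1 b_cs !inE eqxx.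
have U2 : uniq (unzip2 Y) by rewrite /= u2 m2 b_cs' !inE eqxx.
have M1 v : v \in unzip1 Y by rewrite /= inE m1 b_cs !inE orbN.
have M2 v : v \in unzip2 Y by rewrite /= inE m2 b_cs' !inE orbN.
pose f u := nth h' (unzip2 Y) (index u (unzip1 Y)).
pose g w := nth h (unzip1 Y) (index w (unzip2 Y)).
have sz : size (unzip1 Y) = size (unzip2 Y) by rewrite !size_map.
have fK : cancel f g.
  by move=> u; rewrite /g index_uniq -?sz ?index_mem // nth_index.
have gK : cancel g f.
  by move=> w; rewrite /f index_uniq ?sz ?index_mem // nth_index.
have fP u w : (u, w) \in Y -> f u = w by apply: unzip_pair.
have fh : f h = h' by apply: fP; rewrite mem_head.
have fY u : (u, f u) \in Y.
  by have /mapP[[u' w] uwY /= ->] := M1 u; rewrite (fP _ _ uwY).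
have f_par u : u != h -> f (par u) = par' (f u).
  move=> nu; apply: fP; have := fY u; rewrite inE => /orP[/eqP[eq_u]|/pZ[uw|uw]].
  - by rewrite eq_u eqxx in nu.
  - have [ucs ucs'] := mem_zip uw.
    have [_ ->] := siblings_mem sib ucs; have [_ ->] := siblings_mem sib' ucs'.
    by rewrite mem_head.
  - by rewrite inE uw orbT.
exists f; split; first by exists g.
have f_eq := inj_eq (can_inj fK).
move=> x y; rewrite (adj_par Gr) (adj_par Gr') -fh !f_eq; congr (_ || _).
  by have [//|nx] := eqVneq x h; rewrite /= -f_par // f_eq.
by have [//|ny] := eqVneq y h; rewrite /= -f_par // f_eq.
Qed.

Lemma unbranched_giso :
  unbranched (forest_of h par depth (children h par h)) ->
  unbranched (forest_of h' par' depth' (children h' par' h')) ->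
  perm_eq (path_lengths (forest_of h par depth (children h par h)))
          (path_lengths (forest_of h' par' depth' (children h' par' h'))) ->
  giso G G'.
Proof.
move=> ub ub' eq_d.
apply: (forest_giso (siblings_sorted h par depth) (siblings_sorted h' par' depth')).
- exact: perm_sorted_children.
- exact: perm_sorted_children.
rewrite !sorted_forest //; congr chains.
by apply/perm_sortP => //; [apply: leq_total|apply: leq_trans|apply: anti_leq].
Qed.
End Isomorphism.

(** * Centroids and the extremal bound *)

Lemma unbranched_Fstar (G : sgraph) (h : G) par depth (Gr : rooted h par depth) :
  ~~ leaf h -> unbranched (forest_of h par depth (children h par h)) ->
  Fstar G = spider_value (path_lengths (forest_of h par depth (children h par h))).
Proof.
move=> nlh; set f := forest_of _ _ _ _ => ub; rewrite (FstarE Gr nlh) -/f.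
have [] := chains_data (branch_sizes_gt0 f).
rewrite -(unbranched_chains ub) -(path_lengths_unbranched ub) => -> -> ->.
by rewrite addnC.
Qed.

(** Moving from [h] to a neighbour [c] brings the descendants of [c] closer by one
    and the other vertices farther by at most one. So if [h] has least total
    distance, the descendants of [c] are at most half of the vertices. *)
Lemma centroid_exists (G : sgraph) : tree G ->
  exists (h : G) par depth, rooted h par depth /\
    forall c, c \in children h par h -> 2 * #|below par c| <= #|G|.
Proof.
move=> [/connected_setTP[[h0 _] conn] acyc].
pose W h := \sum_v dist conn h v.
case: (@arg_minnP _ h0 xpredT W isT) => h _ min_h.
exists h, (toward conn h), (dist conn h); have Gr := dist_rooted conn h acyc.
split=> // c; rewrite mem_children => /andP[nc /eqP pc].
have hc : adj h c by rewrite adjC -[X in adj _ X]pc (rooted_adj_par Gr nc).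
set B := below _ c.
have near v : v \in B -> (dist conn c v).+1 <= dist conn h v.
  move: v; apply: (rooted_ind Gr) => [|v nv IH].
    by rewrite (below_par Gr) 1?eq_sym // eqxx.
  have [->|nvc] := eqVneq v c.
    by rewrite (depth_par Gr nc) pc dist0.
  rewrite /B (below_par Gr) // => /andP[_ /IH]; rewrite (depth_par Gr nv) ltnS.
  by apply: leq_trans; apply: dist_adj; rewrite adjC (rooted_adj_par Gr).
have far v : dist conn c v <= (dist conn h v).+1.
  move: v; apply: (rooted_ind Gr) => [|v nv IH].
    by rewrite !dist0 -(dist0 conn c); apply: dist_adj; rewrite adjC.
  have := @dist_adj _ conn c (toward conn h v) v; rewrite adjC (rooted_adj_par Gr nv).
  by rewrite (depth_par Gr nv) => /(_ isT)/leq_trans; apply.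
have : W c + 2 * #|B| <= W h + #|G|.
  rewrite -sum1_card -[#|G|]sum1_card big_mkcond big_distrr -!big_split /=.
  apply: leq_sum => v _; case: ifP => [/near|_]; first by lia.
  by rewrite addn0 addn1.
have := min_h c isT; lia.
Qed.

Lemma card_below (G : sgraph) (h : G) par depth (Gr : rooted h par depth) c :
  c != h -> #|below par c| = (fsize (subforest h par depth c)).+1.
Proof.
move=> nc; have sib : siblings h par (par c) [:: c] by rewrite /siblings /= nc eqxx.
have := card_belows_forest Gr sib; rewrite /= addn0 => <-.
by congr #|pred_of_set _|; apply/setP=> v; rewrite [in RHS]inE /= orbF.
Qed.

(** The last clause replaces, for two leaves, the strictness of smoothing: two
    branches each with at most [n / 2] of the [n - 1] other vertices differ by at
    most one. *)
Lemma tree_bound (G : sgraph) n k : tree_with_leaves G n k -> 2 < n ->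
  exists (h : G) par depth, let f := forest_of h par depth (children h par h) in
  [/\ rooted h par depth, Fstar G + ~~ unbranched f <= spider_value (path_lengths f),
      size (path_lengths f) = k, sumn (path_lengths f) = n - 1 &
      unbranched f -> k = 2 -> balanced (path_lengths f)].
Proof.
case=> treeG sz_n sz_k n_gt2; have [h [par [depth [Gr small]]]] := centroid_exists treeG.
exists h, par, depth; set f := forest_of _ _ _ _ => /=.
have sz_f : n = (fsize f).+1 by rewrite -sz_n (card_rooted Gr).
have {}small : all (fun b => 2 * b <= (fsize f).+1) (branch_sizes f).
  rewrite branch_sizes_forest all_map; apply/allP=> c c_h /=.
  have nc : c != h by move: c_h; rewrite mem_children => /andP[].
  by rewrite -(card_below Gr nc) -sz_f -sz_n small.
have multi : ~~ is_single f.
  apply: contraL n_gt2; rewrite sz_f; case: (f) small => // t [|//] /=.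
  by rewrite addn0 andbT; lia.
have nlh : ~~ leaf h.
  apply: contra multi; rewrite /leaf (degreeE Gr) eqxx addn0 /f.
  by case: (children h par h) => [|c []].
have sz_d : size (path_lengths f) = k by rewrite -sz_k (card_leaves Gr nlh).
split=> //; last 2 first.
- by rewrite sumn_path_lengths sz_f subn1.
- move=> ub k2; move: sz_d (sumn_path_lengths f) small.
  rewrite k2 -(path_lengths_unbranched ub); case: (path_lengths f) => [|a [|b []]] //= _ eq_s.
  rewrite andbT => /andP[la lb]; apply/balancedP=> p q.
  by rewrite !inE => /orP[] /eqP-> /orP[] /eqP->; lia.
have := root_bound multi small; rewrite (FstarE Gr nlh) -/f /spider_value sumn_path_lengths.
have := prod0_leS (path_lengths f); have [[_ le_i _ _] _ _] := dominated_forest f.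
by move: le_i; lia.
Qed.

(** The hub is not a leaf: otherwise the empty leg is one of the legs, the others
    have length at most one, and the tree has only two vertices. *)
Lemma balanced_spider_forest (T : sgraph) n k : balanced_spider T n k ->
  2 < n -> 1 < k ->
  exists (h : T) par depth, let f := forest_of h par depth (children h par h) in
  [/\ [/\ rooted h par depth, ~~ leaf h & unbranched f],
      balanced (path_lengths f), size (path_lengths f) = k & sumn (path_lengths f) = n - 1].
Proof.
case=> sz_n [treeT _] [h [legs [hub_h [uniq_l sz_l] mem_l bal]]] n_gt2 k_gt1.
have [/connected_setTP[_ conn] acyc] := treeT.
have Gr := dist_rooted conn h acyc; move: Gr.
move: (toward conn h) (dist conn h) => par depth Gr.
exists h, par, depth; set f := forest_of _ _ _ _ => /=.
have eq_legs := perm_leg_sizes Gr uniq_l mem_l.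
have sz_f : n = (fsize f).+1 by rewrite -sz_n (card_rooted Gr).
have sib := siblings_children h par h.
have ub := hub_unbranched Gr hub_h sib.
have nlh : ~~ leaf h.
  apply/negP=> lh; have leg0 : [::] \in legs by rewrite mem_l /leg /= lh.
  have [p p_legs np] : exists2 p, p \in legs & p != [::].
    have : has (predC1 [::]) legs.
      rewrite has_predC; apply/negP=> all0; move: uniq_l sz_l k_gt1.
      case: legs all0 {bal mem_l leg0 eq_legs} => [|a [|b l]] //=; try lia.
      by case/and3P=> /eqP-> /eqP-> _; rewrite inE eqxx.
    by case/hasP=> p; exists p.
  have := bal _ _ p_legs leg0; move: p_legs; rewrite mem_l => /(legP Gr)[v lv eq_p].
  have nv : v != h by apply: contraNneq np => v_h; rewrite eq_p v_h (root_path_root Gr).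
  rewrite eq_p size_root_path (depth_par Gr nv) /= add0n => dv.
  have pv : par v = h.
    apply/eqP; case: eqVneq => // npv; move: dv; rewrite (depth_par Gr npv); lia.
  move: lv lh; rewrite (leaf_children Gr nv) /leaf (degreeE Gr) eqxx addn0 => /eqP cv.
  have : v \in children h par h by rewrite mem_children nv pv eqxx.
  move: sz_f n_gt2; rewrite /f; case: (children h par h) => [|c [|? ?]] //=.
  rewrite inE => + + /eqP eq_c; rewrite -eq_c (subforestE Gr) cv /=; lia.
have perm_d := perm_leaf_depths Gr nlh ub.
have perm_l := perm_trans eq_legs perm_d.
split=> //.
- apply/balancedP=> p q; rewrite -!(perm_mem perm_l) => /mapP[P P_l ->] /mapP[Q Q_l ->].
  exact: bal.
- by rewrite -(perm_size perm_l) size_map.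
- by rewrite sumn_path_lengths sz_f subn1.
Qed.

(** * A balanced spider *)

(** On the vertices [0, ..., m], joining each [v > 0] to [v - k], truncated at [0],
    deals the vertices to [k] legs in turn, one leg per residue class. *)
Section RoundRobin.
Variables (m k : nat).
Hypothesis k_gt0 : 0 < k.

Definition back (v : 'I_m.+1) : 'I_m.+1 := inord (v - k).

Lemma val_back v : back v = v - k :> nat.
Proof. by rewrite inordK // (leq_ltn_trans (leq_subr _ _)). Qed.

Definition round_robin_adj : rel 'I_m.+1 :=
  [rel x y | (x != ord0) && (back x == y) || (y != ord0) && (back y == x)].

Lemma round_robin_sym : symmetric round_robin_adj.
Proof. by move=> x y; rewrite /round_robin_adj /= orbC. Qed.

Lemma round_robin_irrefl : irreflexive round_robin_adj.
Proof.
move=> x; rewrite /round_robin_adj /= orbb; apply/negP=> /andP[nx /eqP/(congr1 val)] /=.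
by move: nx; rewrite val_back -val_eqE /=; lia.
Qed.

Definition round_robin := SGraph round_robin_sym round_robin_irrefl.

Lemma round_robin_rooted :
  @rooted round_robin ord0 back (fun v : 'I_m.+1 => ceil_div v k).
Proof.
split=> //.
- by apply: val_inj; rewrite /= val_back.
- by rewrite /ceil_div /= add0n divn_small // prednK.
move=> v nv; rewrite val_back /ceil_div.
have v_gt0 : 0 < v by rewrite lt0n -(inj_eq val_inj) in nv *.
have [le_kv|lt_vk] := leqP k v.
  by rewrite -{1}(subnK le_kv) addnAC divnDr ?dvdnn // divnn k_gt0 addn1.
have -> : v - k = 0 by lia.
rewrite add0n [k.-1 %/ k]divn_small ?prednK //.
have -> : v + k.-1 = 1 * k + v.-1 by lia.
by rewrite divnMDl // divn_small //; lia.
Qed.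
End RoundRobin.

Lemma card_ord_lt N a : a <= N -> #|[set v : 'I_N | v < a]| = a.
Proof.
move=> le_aN; rewrite -sum1_card -[RHS]card_ord -sum1_card.
by rewrite (big_ord_widen N (fun _ => 1) le_aN); apply: eq_bigl => v; rewrite inE.
Qed.

Lemma round_robin_balanced m k (k_gt0 : 0 < k) : 1 < k <= m ->
  balanced_spider (round_robin m k_gt0) m.+1 k.
Proof.
case/andP=> k_gt1 le_km; set T := round_robin m k_gt0.
pose h : T := ord0; pose par : T -> T := @back m k.
pose depth (v : T) := ceil_div (v : 'I_m.+1) k.
have Gr : rooted h par depth := round_robin_rooted m k_gt0.
have childE (c v : T) : (v \in children h par c) =
    (0 < (v : 'I_m.+1)) && ((v : 'I_m.+1) - k == (c : 'I_m.+1) :> nat).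
  by rewrite mem_children /par -!(inj_eq val_inj) /= val_back lt0n.
have childS (c v : T) : c != h -> (v \in children h par c) =
    ((v : 'I_m.+1) == (c : 'I_m.+1) + k :> nat).
  by rewrite childE -(inj_eq val_inj) /= => nc; apply/idP/idP; lia.
have short (c : T) : c != h -> size (children h par c) <= 1.
  move=> nc; have := enum_uniq [pred v | (v != h) && (par v == c)].
  rewrite -/(children h par c); have eq_v v := childS c v nc.
  case: (children h par c) eq_v => [|a [|b s]] // eq_v /= /andP[+ _].
  have := eq_v a; have := eq_v b; rewrite !inE !eqxx orbT /=.
  move=> /esym/eqP eq_b /esym/eqP eq_a; case/norP => /eqP[].
  by apply: val_inj; rewrite /= eq_a.
have leafS (c : T) : c != h -> leaf c = (m < (c : 'I_m.+1) + k).
  move=> nc; rewrite (leaf_children Gr nc); apply/eqP/idP=> [no_child|lt_mc].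
    rewrite ltnNge; apply/negP=> le_cm.
    have : (inord (c + k) : 'I_m.+1) \in children h par c by rewrite childS // inordK.
    by rewrite no_child.
  case eq_c: (children h par c) => [|v s] //.
  have : v \in children h par c by rewrite eq_c mem_head.
  by rewrite childS //; have := ltn_ord (v : 'I_m.+1); lia.
have nlh : ~~ leaf h.
  apply/negP; rewrite /leaf (degreeE Gr) eqxx addn0.
  have in_h i : 0 < i <= k -> (inord i : 'I_m.+1) \in children h par h.
    by move=> le_i; rewrite childE inordK /=; lia.
  have := in_h 1; have := in_h 2; case: (children h par h) => [|v [|? ?]] //.
  rewrite !inE k_gt1 k_gt0 => /(_ isT)/eqP eq2 /(_ isT)/eqP eq1 _.
  have : (inord 2 : 'I_m.+1) = inord 1 by rewrite [RHS]eq1 [LHS]eq2.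
  by move/(congr1 val); rewrite /= !inordK //; lia.
have leafE (c : T) : leaf c = (m < (c : 'I_m.+1) + k).
  have [->|nc] := eqVneq c h; last exact: leafS.
  by rewrite (negPf nlh) /=; apply/esym/negbTE; rewrite -leqNgt.
split; first exact: card_ord.
  split; first exact: rooted_tree Gr.
  rewrite -[X in _ <= X](cards1 h); apply/subset_leq_card/subsetP=> v; rewrite !inE.
  by apply: contraTT => nv; rewrite (degreeE Gr) nv; have := short v nv; lia.
exists h, [seq root_path par depth v | v <- enum (leaves T)]; split.
- move=> v; rewrite (degreeE Gr); have [//|nv] := eqVneq v h.
  by have := short v nv; lia.
- rewrite map_inj_uniq ?enum_uniq; last exact: can_inj (last_root_path Gr).
  split=> //; rewrite size_map -cardE.
  have := cardsC (leaves T); rewrite [in RHS]card_ord.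
  have -> : ~: leaves T = [set v : 'I_m.+1 | v < m.+1 - k].
    by apply/setP=> v; rewrite !inE leafE; apply/idP/idP; lia.
  by rewrite card_ord_lt; lia.
- move=> p; apply/mapP/(legP Gr) => [[v]|[v lv ->]].
    by rewrite mem_enum inE => lv ->; exists v.
  by exists v; rewrite // mem_enum inE.
move=> p q /mapP[v + ->] /mapP[w + ->]; rewrite !mem_enum !inE !leafE => lv lw.
rewrite !size_root_path /depth /ceil_div.
have -> : ((w : 'I_m.+1) + k.-1) %/ k + 1 = ((w : 'I_m.+1) + k.-1 + k) %/ k.
  by rewrite [RHS]divnDr ?dvdnn // divnn k_gt0.
by apply: leq_div2r; have := ltn_ord (v : 'I_m.+1); lia.
Qed.

Theorem theorem4p7 (n k : nat) (hn : 2 <= n) (hk : 2 <= k <= n - 1) :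
  (exists T : sgraph, balanced_spider T n k) /\
  (forall T : sgraph, balanced_spider T n k ->
    [/\ Fstar_maximizer n k T,
        forall G : sgraph, Fstar_maximizer n k G -> giso G T &
        forall i j : nat, i + j = k -> n - 1 = j %[mod k] ->
          let a := (n - 1) %/ k in
          let b := ceil_div (n - 1) k in
          Fstar T = (a + 1) ^ i * (b + 1) ^ j - a ^ i * b ^ j
                    + i * a + j * b]).
Proof.
have [k_gt1 le_kn] := andP hk; have n_gt2 : 2 < n by lia.
split.
  have k_gt0 := ltnW k_gt1; exists (round_robin n.-1 k_gt0).
  have := @round_robin_balanced n.-1 k k_gt0; rewrite prednK; last by lia.
  by apply; lia.
move=> T spT; have [h [par [depth /=]]] := balanced_spider_forest spT n_gt2 k_gt1.
set f := forest_of _ _ _ _; case=> [[Gr nlh ub] bal sz sm].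
have FT := unbranched_Fstar Gr nlh ub; rewrite -/f in FT.
have TnkT : tree_with_leaves T n k.
  by case: spT => sz_n [treeT _] _; split; rewrite // (card_leaves Gr nlh).
have nz (ls : seq nat) : size ls = k -> ls != [::].
  by move=> sz_ls; rewrite -size_eq0 sz_ls; lia.
have maxT : Fstar_maximizer n k T.
  split=> // G TnkG; have [h' [par' [depth' /=]]] := tree_bound TnkG n_gt2.
  set f' := forest_of _ _ _ _; case=> Gr' leF sz' sm' _.
  apply: leq_trans (leq_addr _ _) (leq_trans leF _); rewrite FT.
  have := spider_value_max (path_lengths_gt0 f') bal (nz _ sz').
  rewrite sz sz' sm sm' => /(_ erefl erefl); exact: leq_trans (leq_addr _ _).
split=> // [G [TnkG maxG]|i j eq_k eq_m].
  have [h' [par' [depth' /=]]] := tree_bound TnkG n_gt2.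
  set f' := forest_of _ _ _ _; case=> Gr' leF sz' sm' bal2.
  have := maxG T TnkT; rewrite FT => le_TG.
  have := spider_value_max (path_lengths_gt0 f') bal (nz _ sz').
  rewrite sz sz' sm sm' => /(_ erefl erefl) le_v.
  (* equality throughout leaves no room for a branching vertex in [G] *)
  have ub' : unbranched f' by case: (unbranched f') leF => //=; lia.
  (* nor for unbalanced legs: by strict smoothing, or by the choice of the root *)
  have bal' : balanced (path_lengths f').
    have [lt_k|le_k] := ltnP 2 k; last by apply: bal2 => //; lia.
    by move: le_v; rewrite lt_k andbT; case: balanced => //=; lia.
  apply: (unbranched_giso Gr' Gr ub' ub); rewrite -/f -/f'.
  rewrite -(perm_sort leq) sort_balanced ?nz // sz' sm' -sz -sm.
  by rewrite -sort_balanced ?nz // perm_sort.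
by rewrite FT; apply: spider_value_formula => //; lia.
Qed.
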